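(* For $\lambda\in[0,4]$ let $f_\lambda\colon[0,1]\to[0,1]$, $f_\lambda(x)=\lambda x(1-x)$. Then $h_{\mathrm{pol}}(f_\lambda)=0$ when $0$ is an attracting fixed point of $f_\lambda$; and for parameter values $1<\lambda<\lambda_\infty$ (in the period-doubling cascade), if $f_\lambda$ has an attracting periodic cycle of period $2^n$, $n\ge 0$, then $h_{\mathrm{pol}}(f_\lambda)=n+1$.
   Context: $\lambda_\infty$ denotes the Feigenbaum parameter, i.e. the limit of the increasing sequence of period-doubling bifurcation parameters of the logistic family (the first parameter at which the set of periodic points of $f_\lambda$ is no longer finite). ''Attracting'' is understood topologically in $[0,1]$: a cycle is attracting if it has a neighborhood in $[0,1]$ all of whose points have trajectories converging to the cycle. This includes the ''weakly attracting'' cycles at bifurcation parameters, for which the product of the derivatives along the cycle has absolute value $1$; in particular $0$ is an attracting fixed point for $0\le\lambda\le1$, and an attracting fixed point is an attracting cycle of period $2^0$. Polynomial entropy: $S$ is $(n,\varepsilon,f)$-separated if $\max_{0\le i\le n-1}|f^i(x)-f^i(y)|>\varepsilon$ for any distinct $x,y\in S$; $\mathrm{sep}(n,\varepsilon,f)$ is the maximal cardinality of an $(n,\varepsilon,f)$-separated set; $h_{\mathrm{pol}}(f)=\lim_{\varepsilon\to0}\limsup_{n\to\infty}\frac{\log\mathrm{sep}(n,\varepsilon,f)}{\log n}$. *)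

(* Defs.v *)
From HB Require Import structures.
From mathcomp Require Import all_boot all_order all_algebra.
From mathcomp Require Import finmap.
From mathcomp Require Import all_classical all_reals all_analysis.

Set Implicit Arguments.
Unset Strict Implicit.
Unset Printing Implicit Defensive.

Import Order.TTheory GRing.Theory Num.Theory.
Import numFieldNormedType.Exports.

Local Open Scope classical_set_scope.
Local Open Scope ring_scope.

Definition logistic (R : realType) (lam x : R) : R := lam * x * (1 - x).

(* A self-map of a set I of reals is represented by a total function f : R -> R
   of which only the values on I are used. *)

Definition periodic_points (R : realType) (I : set R) (f : R -> R) : set R :=
  [set x | I x /\ exists2 m : nat, (0 < m)%N & iter m f x = x].

Definition has_least_period (R : realType) (f : R -> R) (m : nat) (p : R) :
    Prop :=
  [/\ (0 < m)%N, iter m f p = p &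
      forall k : nat, (0 < k < m)%N -> iter k f p <> p].

Definition forward_orbit (R : realType) (f : R -> R) (p : R) : set R :=
  range (fun i : nat => iter i f p).

Definition converges_to_set (R : realType) (u : nat -> R) (C : set R) : Prop :=
  forall e : R, 0 < e -> \forall n \near \oo, exists2 c, C c & `|u n - c| < e.

(* No condition on derivatives: weakly attracting cycles and cycles attracting
   from one side at an end point of I are included. *)
Definition attracting_set (R : realType) (I : set R) (f : R -> R) (C : set R) :
    Prop :=
  exists U : set R, [/\ open U, C `<=` U &
    forall x, (U `&` I) x -> converges_to_set (fun n => iter n f x) C].

Definition attracting_periodic_point (R : realType) (I : set R) (f : R -> R)
    (m : nat) (p : R) : Prop :=
  [/\ I p, has_least_period f m p & attracting_set I f (forward_orbit f p)].

(* The Feigenbaum parameter, as the first parameter at which the set of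
   periodic points is no longer finite. *)
Definition feigenbaum (R : realType) : R :=
  inf [set lam : R | 0 <= lam <= 4 /\
         infinite_set (periodic_points `[0, 1] (logistic lam))].

Definition separated (R : realType) (I : set R) (f : R -> R) (n : nat) (e : R)
    (S : {fset R}) : Prop :=
  [set` S] `<=` I /\
  forall x y : R, x \in S -> y \in S -> x != y ->
    exists2 i : nat, (i < n)%N & e < `|iter i f x - iter i f y|.

(* For 0 < e the supremum is a maximum when I is compact and f is continuous on
   I with f @` I `<=` I. *)
Definition sep (R : realType) (I : set R) (f : R -> R) (n : nat) (e : R) :
    \bar R :=
  ereal_sup [set (#|` S|%:R)%:E | S in separated I f n e].

(* The quotient is irrelevant for n <= 1, where ln n%:R = 0. *)
Definition sep_growth (R : realType) (I : set R) (f : R -> R) (e : R) :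
    \bar R :=
  limn_esup (fun n : nat => lne (sep I f n e) / (ln (n%:R : R))%:E)%E.

Definition hpol (R : realType) (I : set R) (f : R -> R) : \bar R :=
  lim (sep_growth I f e @[e --> 0^'+]).

Lemma sep_nincr (R : realType) (I : set R) (f : R -> R) (n : nat) (e e' : R) :
  e <= e' -> (sep I f n e' <= sep I f n e)%E.
Proof.
move=> ee'; apply: ereal_sup_le => _ [S [SI sepS] <-]; exists S => //.
split=> // x y xS yS xy; have [i ilt h] := sepS x y xS yS xy.
by exists i => //; apply: le_lt_trans h.
Qed.

Lemma sep_ge0 (R : realType) (I : set R) (f : R -> R) (n : nat) (e : R) :
  (0 <= sep I f n e)%E.
Proof.
apply: ereal_sup_ubound; exists fset0; last by rewrite cardfs0.
by split=> [x|x y]; rewrite /= inE.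
Qed.

Lemma sep_growth_nincr (R : realType) (I : set R) (f : R -> R) (e e' : R) :
  e <= e' -> (sep_growth I f e' <= sep_growth I f e)%E.
Proof.
move=> ee'; rewrite /sep_growth !limn_esup_lim.
apply: lee_lim; [exact: is_cvg_esups|exact: is_cvg_esups|].
apply: nearW => n; apply: ge_ereal_sup => _ [m /= nm <-].
apply: le_trans (ereal_sup_ubound _); last by exists m.
apply: lee_wpmul2r.
  rewrite inve_ge0 lee_fin; case: m {nm} => [|m]; first by rewrite ln0.
  by rewrite ln_ge0// ler1n.
by rewrite lee_lne ?in_itv/= ?sep_ge0 ?leey// sep_nincr.
Qed.

(* The limit in hpol always exists, in \bar R. *)
Lemma is_cvg_hpol (R : realType) (I : set R) (f : R -> R) :
  cvg (sep_growth I f e @[e --> 0^'+]).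
Proof.
apply: nonincreasing_at_right_is_cvge; apply: nearW => x y z _ _ yz.
exact: sep_growth_nincr.
Qed.

(* Main.v *)
(* Let T be unimodal on [a, b] with T a = T b = a and critical point c, and
   suppose that T expands the cross-ratio of any four points of a lap, as a
   quadratic map does by a direct computation. Besides a, the maps considered
   have at most one fixed point p. If there is no p, all trajectories converge
   to a; if p <= c, all those that do not end at a converge to p. If c < p, let
   q < c < p < b1 with T q = p and T b1 = q: either T c < b1 and the square of T
   is again of this kind on [p, b1] (by cross-ratios), or it maps two intervals
   over [p, b1] and T has infinitely many periodic points. Finiteness of the set
   of periodic points thus forces finitely many renormalizations. The number of
   repelling left ends met on the way is the polynomial entropy, and it
   determines the period of the attracting cycle, because arbitrarily close to
   any other cycle there are trajectories that accumulate elsewhere.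
   Each repelling left end contributes one factor n to the number of separated
   orbits: an orbit may leave a at any of n times (pulling points back along the
   branch at a gives the lower bound), and once it has left a neighbourhood of a
   it comes to [p, b1], or close to the attracting fixed point, after a bounded
   time (whence the upper bound). *)

Require Import Defs.
From mathcomp Require Import all_boot all_order all_algebra finmap.
From mathcomp Require Import all_classical all_reals all_analysis.
From mathcomp Require Import zify ring lra.

Set Implicit Arguments.
Unset Strict Implicit.
Unset Printing Implicit Defensive.

Import Order.TTheory GRing.Theory Num.Theory.
Import numFieldNormedType.Exports.
Local Open Scope classical_set_scope.
Local Open Scope ring_scope.

Lemma leq_exp2rW m n k : (m <= n)%N -> (m ^ k <= n ^ k)%N.
Proof. by case: k => // k; rewrite leq_exp2r. Qed.

(** * Growth of separated sets *)

(** Working with natural numbers postpones the extended reals to the very end. [A] need not be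
    invariant: orbits may be counted from a small cell and followed after they leave it. *)
Definition sep_bound (R : realType) (A : set R) (f : R -> R) (n : nat) (e : R)
    (K : nat) : Prop :=
  forall S : {fset R}, Defs.separated A f n e S -> (#|` S| <= K)%N.

Section SepBound.
Context {R : realType}.
Implicit Types (A B : set R) (f : R -> R) (e u v x y : R) (n k j K : nat)
  (S : {fset R}).

Lemma sep_boundS A B f n e K :
  A `<=` B -> sep_bound B f n e K -> sep_bound A f n e K.
Proof. by move=> AB bK S [SA sS]; apply: bK; split => // x /SA /AB. Qed.

Lemma sep_bound_leq A f n m e K :
  (n <= m)%N -> sep_bound A f m e K -> sep_bound A f n e K.
Proof.
move=> nm bK S [SA sS]; apply: bK; split=> // x y xS yS xy.
by have [i iN ?] := sS x y xS yS xy; exists i => //; apply: leq_trans nm.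
Qed.

Lemma sep_bound_weak A f n e K K' :
  (K <= K')%N -> sep_bound A f n e K -> sep_bound A f n e K'.
Proof. by move=> KK' bK S /bK h; apply: leq_trans KK'. Qed.

Lemma sep_bound_union A B f n e K K' :
  sep_bound A f n e K -> sep_bound B f n e K' ->
  sep_bound (A `|` B) f n e (K + K').
Proof.
move=> bA bB S [SAB sS].
pose S1 := [fset x in S | `[< A x >]]%fset.
pose S2 := [fset x in S | `[< B x >]]%fset.
have -> : S = (S1 `|` S2)%fset.
  apply/fsetP => x; rewrite !inE; case: (boolP (x \in S)) => //= xS.
  by have [|] := SAB x xS => ?; symmetry; apply/orP; [left|right];
    apply/asboolP.
apply: leq_trans (leq_add (bA S1 _) (bB S2 _)).
- by rewrite cardfsU leq_subr.
- split=> [x|x y]; first by rewrite /= !inE => /andP[_ /asboolP].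
  by rewrite !inE => /andP[xS _] /andP[yS _]; exact: sS.
- split=> [x|x y]; first by rewrite /= !inE => /andP[_ /asboolP].
  by rewrite !inE => /andP[xS _] /andP[yS _]; exact: sS.
Qed.

Lemma sep_bound_small A f n e :
  (forall i x y, (i < n)%N -> A x -> A y -> `|iter i f x - iter i f y| <= e) ->
  sep_bound A f n e 1.
Proof.
move=> h S [SA sS]; rewrite leqNgt; apply/negP => S1.
have [x xS] : exists x, x \in S.
  by apply/fset0Pn; rewrite -cardfs_gt0; apply: leq_trans S1.
have [y] : exists y, y \in (S `\ x)%fset.
  by apply/fset0Pn; rewrite -cardfs_gt0; move: S1; rewrite (cardfsD1 x) xS.
rewrite !inE => /andP[yx yS].
have [i iN] := sS y x yS xS yx.
by rewrite ltNge h //; [exact: SA|exact: SA].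
Qed.

(** No two points of [A] are separated at time 0, so [f] carries a separated set injectively to one
    in [B] that is separated within one step less. *)
Lemma sep_bound_cell A B f n e K :
  (forall x y, A x -> A y -> `|x - y| <= e) -> (forall x, A x -> B (f x)) ->
  sep_bound B f n e K -> sep_bound A f n.+1 e K.
Proof.
move=> dA AB bK S [SA sS].
have shift x y : x \in S -> y \in S -> x != y ->
    exists2 i : nat, (i < n)%N & e < `|iter i f (f x) - iter i f (f y)|.
  move=> xS yS xy; have [[|i] iN] := sS x y xS yS xy.
    by rewrite ltNge /= dA //; exact: SA.
  by exists i => //; rewrite -!iterSr.
have inj : {in S &, injective f}.
  move=> x y xS yS fxy; apply/eqP; apply/negP => /negP xy.
  have [i _] := shift x y xS yS xy; rewrite fxy subrr normr0 => e0.
  have := sS x y xS yS xy; have [j jN _] := sS x y xS yS xy.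
  have : `|x - y| <= e by apply: dA; exact: SA.
  by rewrite leNgt (lt_le_trans e0).
have <- : #|` (f @` S)%fset| = #|` S| by exact: card_in_imfset.
apply: bK; split=> [z /= /imfsetP[x /= xS ->]|]; first exact/AB/SA.
move=> _ _ /imfsetP[x /= xS ->] /imfsetP[y /= yS ->] fxy; apply: shift => //.
by apply: contraNneq fxy => ->.
Qed.

Lemma sep_bound_cells A B f u e : 0 <= e ->
  (forall x, A x -> B (f x)) -> forall j n K, sep_bound B f n e K ->
  sep_bound (A `&` [set x | u <= x < u + j%:R * e]) f n.+1 e (j * K).
Proof.
move=> e0 AB; elim=> [|j IH] n K bK.
  move=> S [SA _]; rewrite mul0n leqn0 cardfs_eq0; apply/eqP/fsetP => x.
  rewrite inE; apply/negP => /SA[_ /=]; rewrite mul0r addr0.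
  by case/andP=> ux /(le_lt_trans ux); rewrite ltxx.
rewrite mulSnr.
apply: (@sep_boundS _ ((A `&` [set x | u <= x < u + j%:R * e]) `|`
   (A `&` [set x | u + j%:R * e <= x < u + j.+1%:R * e]))).
  move=> x [Ax /= /andP[ux xu]]; have [h|h] := ltP x (u + j%:R * e).
    by left; split=> //=; apply/andP.
  by right; split => //=; apply/andP.
apply: sep_bound_union; first exact: IH.
apply: sep_bound_cell bK => [x y [_ /= hx] [_ /= hy]|x [Ax _]]; last exact: AB.
by rewrite ler_norml; move: hx hy; rewrite -natr1; lra.
Qed.

(** [C] is the number of cells of length [e] that cover [[u, v]]. It depends on neither [n] nor [K],
    so one application of [f] costs only a constant factor. *)
Lemma sep_bound_image A B f u v e : 0 < e -> A `<=` `[u, v] ->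
  (forall x, A x -> B (f x)) ->
  exists C, forall n K, sep_bound B f n e K -> sep_bound A f n.+1 e (C * K).
Proof.
move=> e0 Auv AB; pose j := (Num.truncn ((v - u) / e)).+1.
exists j => n K bK.
apply: (@sep_boundS _ (A `&` [set x | u <= x < u + j%:R * e])); last first.
  by apply: sep_bound_cells bK => //; exact: ltW.
move=> x Ax; split=> //=.
have := Auv x Ax; rewrite /= in_itv /= => /andP[-> xv].
rewrite -ltrBlDl -ltr_pdivrMr //; apply: le_lt_trans (truncnS_gt _).
by rewrite ler_pM2r ?invr_gt0 // lerB.
Qed.

Lemma sep_bound_iter A B f u v e j : 0 < e -> A `<=` `[u, v] ->
  (forall x, A x -> A (f x)) -> (forall x, A x -> B (iter j f x)) ->
  exists C, forall n K, sep_bound B f n e K -> sep_bound A f n e (C * K).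
Proof.
move=> e0 Auv AA AB.
(* For the induction on [j] the set must shrink to the points that are in [B] at time [j]; each step
   back costs one constant factor. *)
suff [C hC] : exists C, forall n K, sep_bound B f n e K ->
    sep_bound (A `&` [set x | B (iter j f x)]) f n e (C * K).
  by exists C => n K /hC; apply: sep_boundS => x Ax; split => //; exact: AB.
elim: j {AB} => [|j [C hC]].
  by exists 1%N => n K; rewrite mul1n; apply: sep_boundS => x [].
have [] := @sep_bound_image (A `&` [set x | B (iter j.+1 f x)])
  (A `&` [set x | B (iter j f x)]) f u v e e0.
- by move=> x [/Auv].
- by move=> x [Ax]; rewrite /= -iterS iterSr => Bx; split => //; exact: AA.
move=> C' hC'; exists (C' * C)%N => n K /hC /hC'; rewrite mulnA.
exact: sep_bound_leq.
Qed.

End SepBound.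

(** The base [n.+1] keeps the bound positive at [n = 0], where singletons are still separated. *)
Definition pol_upper (R : realType) (k : nat) (f : R -> R) (A : set R)
    (e : R) : Prop :=
  exists C : nat, forall n : nat, sep_bound A f n e (C * n.+1 ^ k).

(** * Polynomial upper bounds *)

Section PolUpper.
Context {R : realType}.
Implicit Types (A B : set R) (f : R -> R) (e u v x y : R) (n k j : nat).

Lemma pol_upperS k f A B e :
  A `<=` B -> pol_upper k f B e -> pol_upper k f A e.
Proof. by move=> AB [C hC]; exists C => n; apply: sep_boundS (hC n). Qed.

Lemma pol_upper_union k f A B e : pol_upper k f A e -> pol_upper k f B e ->
  pol_upper k f (A `|` B) e.
Proof.
move=> [C hC] [D hD]; exists (C + D)%N => n; rewrite mulnDl.
exact: sep_bound_union.
Qed.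

Lemma pol_upper_image k f A B u v e : 0 < e -> A `<=` `[u, v] ->
  (forall x, A x -> B (f x)) -> pol_upper k f B e -> pol_upper k f A e.
Proof.
move=> e0 Auv AB [C hC]; have [D hD] := sep_bound_image e0 Auv AB.
exists (D * C)%N => n; rewrite -mulnA; apply: sep_bound_leq (leqnSn n) _.
exact: hD.
Qed.

Lemma pol_upper_iter k f A B u v e j : 0 < e -> A `<=` `[u, v] ->
  (forall x, A x -> A (f x)) -> (forall x, A x -> B (iter j f x)) ->
  pol_upper k f B e -> pol_upper k f A e.
Proof.
move=> e0 Auv AA AB [C hC]; have [D hD] := sep_bound_iter e0 Auv AA AB.
by exists (D * C)%N => n; rewrite -mulnA; exact: hD.
Qed.

(** The points within [e] of [u] form one cell, so going from [n] to [n.+1] steps adds at most the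
    count for the points beyond [u + e], of order [n ^ k]. Summation over [n] gives the extra
    factor. *)
Lemma pol_upper_escape k f A u e : 0 < e -> (forall x, A x -> u <= x) ->
  (forall x, A x -> A (f x)) ->
  pol_upper k f (A `&` [set x | u + e <= x]) e -> pol_upper k.+1 f A e.
Proof.
(* The successor covers the case [n = 0], where the count can be 1 even if [C] is 0. *)
move=> e0 Au AA [C hC]; exists C.+1; elim=> [|n IH].
  rewrite exp1n muln1; apply: (@sep_bound_weak _ _ _ _ _ 1) => //.
  exact: sep_bound_small.
apply: (@sep_boundS _ _ ((A `&` [set x | x < u + e]) `|`
                        (A `&` [set x | u + e <= x]))).
  by move=> x Ax; case: (ltP x (u + e)); [left|right].
apply: (@sep_bound_weak _ _ _ _ _ (C.+1 * n.+1 ^ k.+1 + C * n.+2 ^ k)).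
  have := leq_exp2rW k (leqnSn n.+1); rewrite !expnS.
  by nia.
apply: sep_bound_union; last exact: hC.
apply: (sep_bound_cell _ _ IH) => [x y [/Au ux /= xe] [/Au uy /= ye]|x [Ax _]].
  by rewrite ler_norml; lra.
exact: AA.
Qed.

End PolUpper.

(** * From the square of a map to the map *)

Section Square.
Context {R : realType}.
Implicit Types (A B : set R) (f : R -> R) (e u v x y : R) (n k j : nat).

Lemma iter2_double f n x : iter n (iter 2 f) x = iter n.*2 f x.
Proof. by rewrite -muln2 iterM. Qed.

(** An odd time comes one step after an even one, and [f] cannot turn a distance of at most [e / L]
    into one above [e]. *)
Lemma pol_upper_iter2 k f A L e : 0 < e -> 0 < L ->
  (forall x y, A x -> A y -> `|f x - f y| <= L * `|x - y|) ->
  (forall x, A x -> A (iter 2 f x)) ->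
  (forall d, 0 < d -> pol_upper k (iter 2 f) A d) -> pol_upper k f A e.
Proof.
move=> e0 L0 lip AA h; pose d := Num.min e (e / L).
have d0 : 0 < d by rewrite lt_min e0 divr_gt0.
have [C hC] := h d d0; exists C => n S [SA sS].
apply: hC; split=> // x y xS yS xy.
have itA z j : A z -> A (iter j (iter 2 f) z).
  by move=> Az; elim: j => //= j IH; exact: AA.
have [i iN ei] := sS x y xS yS xy.
exists i./2; first by apply: leq_ltn_trans iN; rewrite leq_half_double; lia.
set X := iter i./2 _ x; set Y := iter i./2 _ y.
have ei' : e < `|iter (odd i) f X - iter (odd i) f Y|.
  by rewrite /X /Y !iter2_double -!iterD odd_double_half.
rewrite ltNge; apply/negP; rewrite le_min => /andP[de].
rewrite ler_pdivlMr // mulrC => dL; move: ei'; rewrite ltNge => /negP; apply.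
case: (odd i) => //=; apply: le_trans dL; apply: lip; apply: itA; exact: SA.
Qed.

End Square.

(** Allowing a time linear in [n] changes the logarithm of the time only by a bounded amount, and
    makes the notion insensitive to squaring [f]. One [e] suffices, because a smaller one only makes
    separation easier. *)
Definition pol_lower (R : realType) (k : nat) (f : R -> R) (A : set R) : Prop :=
  exists2 e : R, 0 < e & exists d : nat, forall n : nat, exists2 S : {fset R},
    Defs.separated A f (d * n.+1) e S & (n ^ k <= #|` S|)%N.

(** * Polynomial lower bounds *)

Section PolLower.
Context {R : realType}.
Implicit Types (A B : set R) (f : R -> R) (e u v x y : R) (n k j : nat).

Lemma pol_lowerS k f A B : A `<=` B -> pol_lower k f A -> pol_lower k f B.
Proof.
move=> AB [e e0 [d h]]; exists e => //; exists d => n.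
by have [S [SA sS] nS] := h n; exists S => //; split => // x /SA /AB.
Qed.

Lemma pol_lower0 f A x : A x -> pol_lower 0 f A.
Proof.
move=> Ax; exists 1 => //; exists 0%N => n; exists [fset x]%fset.
  split=> [y|y z]; rewrite /= !inE; first by move=> /eqP ->.
  by move=> /eqP -> /eqP ->; rewrite eqxx.
by rewrite cardfs1.
Qed.

Lemma pol_lower_iter2 k f A : pol_lower k (iter 2 f) A -> pol_lower k f A.
Proof.
move=> [e e0 [d h]]; exists e => //; exists d.*2 => n.
have [S [SA sS] nS] := h n; exists S => //; split => // x y xS yS xy.
have [i iN ei] := sS x y xS yS xy; exists i.*2; last by rewrite -!iter2_double.
by rewrite -doubleMl ltn_double.
Qed.

Lemma iter_section f (D : set R) phi : (forall y, D y -> D (phi y)) ->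
  (forall y, D y -> f (phi y) = y) ->
  forall n y, D y -> D (iter n phi y) /\ iter n f (iter n phi y) = y.
Proof.
move=> DD fK; elim=> [//|n IH] y Dy; have [Dn e] := IH y Dy.
by split; [exact: DD|rewrite iterSr iterS fK].
Qed.

(* The pullbacks of a separated set by the first n iterates of the section phi
   are separated from one another at the times when they return to it. *)
Lemma pol_lower_pullback k f (D B : set R) phi u v : u < v ->
  (forall y, D y -> [/\ D (phi y), phi y <= u & f (phi y) = y]) ->
  B `<=` D -> (forall y, B y -> v <= y) ->
  pol_lower k f B -> pol_lower k.+1 f D.
Proof.
move=> uv hphi BD Bv [e e0 [d h]].
have DD y : D y -> D (phi y) by move=> /hphi[].
have fK y : D y -> f (phi y) = y by move=> /hphi[].
have itP := iter_section DD fK.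
(* Less than the gap between [u] and [v]: at time [i] the [i]-th pullback is back at a point of at
   least [v], while a later one is still at most [u]. *)
pose e' := Num.min e ((v - u) / 2).
have e'0 : 0 < e' by rewrite lt_min e0 divr_gt0 // subr_gt0.
have e'uv : e' < v - u by rewrite gt_min; apply/orP; right; lra.
(* The return to [S] takes fewer than [n] steps, and the separation inside [S] fewer than [d * n.+1]
   more. *)
exists e' => //; exists d.+1 => n; have [S [SB sS] nS] := h n.
have SD y : y \in S -> D y by move=> yS; apply/BD/SB.
have sep_lt i j y z : (i < j)%N -> y \in S -> z \in S ->
    e' < `|iter i f (iter i phi y) - iter i f (iter j phi z)|.
  move=> ij yS zS; rewrite (itP i y (SD _ yS)).2.
  have -> : iter j phi z = iter i phi (iter (j - i) phi z).
    by rewrite -iterD subnKC // ltnW.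
  have [Dz _] := itP (j - i.+1)%N z (SD _ zS).
  have -> : (j - i = (j - i.+1).+1)%N by lia.
  rewrite (itP i _ _).2 iterS; last exact: DD.
  have [_ le_u _] := hphi _ Dz.
  apply: lt_le_trans (ler_norm _); have := Bv _ (SB _ yS); lra.
have sep i j y z : (i < n)%N -> (j < n)%N -> y \in S -> z \in S ->
    (i, y) != (j, z) -> exists2 m, (m < d.+1 * n.+1)%N &
    e' < `|iter m f (iter i phi y) - iter m f (iter j phi z)|.
  move=> iN jN yS zS ne; have [ij|ji|ij] := ltngtP i j.
  - exists i; last exact: sep_lt.
    by apply: leq_trans iN _; rewrite mulSn; lia.
  - exists j; last by rewrite distrC; exact: sep_lt.
    by apply: leq_trans jN _; rewrite mulSn; lia.
  - move: ne; rewrite -ij xpair_eqE eqxx /= => yz.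
    have [m mN em] := sS y z yS zS yz.
    exists (m + i)%N; first by rewrite mulSn; lia.
    rewrite !iterD !(itP i _ _).2; [|exact: SD|exact: SD].
    by rewrite gt_min em.
pose s := [seq iter i phi y | i <- iota 0 n, y <- enum_fset S].
have us : uniq s.
  apply: allpairs_uniq; [exact: iota_uniq|exact: fset_uniq|].
  move=> /= _ _ /allpairsP[[i y] [/= + + ->]] /allpairsP[[j z] [/= + + ->]] /=.
  rewrite !mem_iota !add0n /= => iN yS jN zS eq_.
  apply/eqP; apply/negPn/negP => /(sep i j y z iN jN yS zS)[m _].
  by rewrite eq_ subrr normr0 ltNge ltW.
exists [fset x in s]%fset; last first.
  rewrite card_fseq undup_id // size_allpairs size_iota expnS.
  by rewrite leq_mul2l nS orbT.
split=> [x /=|x y].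
  rewrite inE /= => /allpairsP[[i y] [_ /= yS ->]].
  exact: (itP i y (SD _ yS)).1.
rewrite !inE /= => /allpairsP[[i y'] [/= + yS ->]].
move=> + /allpairsP[[j z] [/= + zS ->]].
rewrite !mem_iota !add0n /= => iN jN ne; apply: sep => //.
by apply: contraNneq ne => -[-> ->].
Qed.

End PolLower.

(** * Polynomial entropy from counting bounds *)

Section Hpol.
Context {R : realType}.
Implicit Types (A B : set R) (f : R -> R) (e u v x y : R) (n k j : nat).

Lemma sep_le A f n e K : sep_bound A f n e K -> (sep A f n e <= K%:R%:E)%E.
Proof.
move=> bK; apply: ge_ereal_sup => _ [S sS <-].
by rewrite lee_fin ler_nat; exact: bK.
Qed.

Lemma sep_ge A f n e (S : {fset R}) : Defs.separated A f n e S ->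
  ((#|` S|%:R)%:E <= sep A f n e)%E.
Proof. by move=> sS; apply: ereal_sup_ubound; exists S. Qed.

Lemma ln_natr_cvgy : ln (n%:R : R) @[n --> \oo] --> +oo.
Proof.
apply/cvgryPge => M; near=> n; rewrite -(expRK M) ler_ln ?posrE ?expR_gt0 //.
  near: n; apply: (cvgryPge _).1; exact: cvgr_idn.
by rewrite ltr0n; near: n; exists 1%N.
Unshelve. all: by end_near. Qed.

Lemma ln_ratio_cvg (a b l : R) (u : nat -> R) :
  (\forall n \near \oo, l * ln n%:R - a <= u n <= l * ln n%:R + b) ->
  u n / ln n%:R @[n --> \oo] --> l.
Proof.
move=> h.
have inv0 : (ln (n%:R : R))^-1 @[n --> \oo] --> (0 : R).
  apply/gtr0_cvgV0; last exact: ln_natr_cvgy.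
  by near=> n; rewrite ln_gt0 // ltr1n; near: n; exists 2%N.
apply: (@squeeze_cvgr _ _ _ _ (fun n => l - a * (ln n%:R)^-1)
  (fun n => l + b * (ln n%:R)^-1)).
- near=> n; have ln0 : 0 < ln (n%:R : R).
    by rewrite ln_gt0 // ltr1n; near: n; exists 2%N.
  have : l * ln n%:R - a <= u n <= l * ln n%:R + b by near: n.
  rewrite ler_pdivlMr // ler_pdivrMr // mulrBl mulrDl.
  by rewrite -![_ * _^-1 * _]mulrA mulVf ?mulr1 // gt_eqF.
- rewrite -[X in _ --> X]subr0 -(mulr0 a); apply: cvgB; first exact: cvg_cst.
  by apply: cvgM => //; exact: cvg_cst.
- rewrite -[X in _ --> X]addr0 -(mulr0 b); apply: cvgD; first exact: cvg_cst.
  by apply: cvgM => //; exact: cvg_cst.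
Unshelve. all: by end_near. Qed.

(** Both bounds are constant multiples of [n ^ k], and the constants disappear on division by
    [ln n]. *)
Lemma sep_growth_eq k f A e (d : nat) : pol_upper k f A e ->
  (forall n, exists2 S : {fset R},
     Defs.separated A f (d * n.+1) e S & (n ^ k <= #|` S|)%N) ->
  sep_growth A f e = k%:R%:E.
Proof.
move=> [C hC] hd; pose D := d.+1.
suff : (lne (sep A f n e) / (ln (n%:R : R))%:E)%E @[n --> \oo] --> k%:R%:E.
  by move=> /cvg_limn_einf_sup[].
have bnd n : (4 * D <= n)%N -> exists s : R, [/\ sep A f n e = s%:E,
   n%:R ^+ k <= (2 * D)%:R ^+ k * s & s <= (C * 2 ^ k)%:R * n%:R ^+ k].
  (* The largest [m] with [m.+1 * D <= n]; since [4 * D <= n], also [n <= m * (2 * D)], so only a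
     constant factor is lost between the times of the lower bound. *)
  move=> Dn; pose m := (n %/ D - 1)%N.
  have [S sS mS] := hd m.
  have q4 : (4 <= n %/ D)%N by rewrite leq_divRL.
  have qE : (n %/ D = m.+1)%N by rewrite /m; lia.
  have mD : (m.+1 * D <= n)%N by rewrite -qE leq_trunc_div.
  have nm : (n <= m * (2 * D))%N.
    apply: leq_trans (ltnW (ltn_ceil n (ltn0Sn d))) _; rewrite -/D qE mulnA.
    by rewrite leq_mul2r; lia.
  have sepS : Defs.separated A f n e S.
    case: sS => SA sS; split=> // x y xS yS xy.
    by have [i iN ?] := sS x y xS yS xy; exists i => //; rewrite /D in mD; nia.
  have le_s := sep_ge sepS; have s_le := sep_le (hC n).
  have sE : sep A f n e = (fine (sep A f n e))%:E.
    rewrite fineK // fin_numE; apply/andP; split.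
      by rewrite gt_eqF // (lt_le_trans _ le_s) // ltNyr.
    by rewrite lt_eqF // (le_lt_trans s_le) // ltry.
  exists (fine (sep A f n e)); split => //.
    move: le_s; rewrite sE lee_fin => le_s.
    apply: (@le_trans _ _ ((2 * D)%:R ^+ k * #|` S|%:R)); last first.
      by rewrite ler_wpM2l // exprn_ge0.
    rewrite -!natrX -natrM ler_nat; apply: leq_trans (leq_mul (leqnn _) mS).
    by rewrite -expnMn; apply: leq_exp2rW; rewrite mulnC.
  move: s_le; rewrite sE lee_fin => /le_trans; apply.
  rewrite -natrX -natrM ler_nat -mulnA -expnMn leq_mul2l; apply/orP; right.
  by apply: leq_exp2rW; lia.
pose s n := fine (sep A f n e).
have bnd' : \forall n \near \oo, sep A f n e = (s n)%:E /\ 0 < s n /\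
    k%:R * ln n%:R - k%:R * ln (2 * D)%:R <= ln (s n)
      <= k%:R * ln n%:R + ln (C * 2 ^ k)%:R.
  exists (4 * D)%N => // n /= /[dup] Dn /bnd[t [st tl tu]].
  have n0 : 0 < (n%:R : R) by rewrite ltr0n /D in Dn *; lia.
  have D0 : 0 < ((2 * D)%:R : R) by rewrite ltr0n.
  have nk0 : 0 < (n%:R : R) ^+ k by rewrite exprn_gt0.
  have Dk0 : 0 < ((2 * D)%:R : R) ^+ k by rewrite exprn_gt0.
  have t0 : 0 < t.
    by rewrite -(pmulr_rgt0 _ Dk0); exact: lt_le_trans tl.
  have C0 : 0 < ((C * 2 ^ k)%:R : R).
    by rewrite -(pmulr_lgt0 _ nk0); exact: lt_le_trans tu.
  rewrite /s st /=; split=> //; split=> //.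
  have : ln (n%:R ^+ k : R) <= ln ((2 * D)%:R ^+ k * t).
    by rewrite ler_ln ?posrE // mulr_gt0.
  have : ln t <= ln ((C * 2 ^ k)%:R * n%:R ^+ k).
    by rewrite ler_ln ?posrE // mulr_gt0.
  rewrite !lnM ?posrE // !lnXn // -![ln _ *+ _]mulr_natl => h1 h2.
  by rewrite lerBlDl h2 addrC.
apply: (@cvg_trans _ ((ln (s n) / ln n%:R)%:E @[n --> \oo])).
  apply: near_eq_cvg; near=> n.
  have [->[s0 _]] : sep A f n e = (s n)%:E /\ 0 < s n /\
    k%:R * ln n%:R - k%:R * ln (2 * D)%:R <= ln (s n)
      <= k%:R * ln n%:R + ln (C * 2 ^ k)%:R by near: n.
  rewrite lne_EFin // inver gt_eqF // ln_gt0 // ltr1n; near: n.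
  by exists 2%N.
apply: cvg_EFin; first by apply: nearW.
apply: (@ln_ratio_cvg (k%:R * ln (2 * D)%:R) (ln (C * 2 ^ k)%:R)).
by apply: filterS bnd' => n [_ []].
Unshelve. all: by end_near. Qed.

(** The growth rate is exactly [k] for every small [e], so the limit is that of an eventually
    constant function. *)
Lemma hpol_eq k f A : (forall e, 0 < e -> pol_upper k f A e) ->
  pol_lower k f A -> hpol A f = k%:R%:E.
Proof.
move=> hU [e0 e00 [d hd]]; rewrite /hpol; apply: lim_near_cst => //.
near=> e; have e_gt0 : 0 < e by near: e; exact: nbhs_right_gt.
apply: (@sep_growth_eq _ _ _ _ d) => [|n]; first exact: hU.
have [S [SA sS] nS] := hd n; exists S => //; split=> // x y xS yS xy.
have [i iN ei] := sS x y xS yS xy; exists i => //; apply: le_lt_trans ei.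
by near: e; apply: nbhs_right_le.
Unshelve. all: by end_near. Qed.

End Hpol.

(** * Iteration of continuous maps *)

Section ContinuousIteration.
Context {R : realType}.
Implicit Types (f h : R -> R) (e u v w x y d : R) (n k : nat).

Lemma ivt_increasing f u v y : continuous f -> u <= v -> f u <= y <= f v ->
  exists2 x, u <= x <= v & f x = y.
Proof.
move=> cf uv /andP[h1 h2]; have fuv := le_trans h1 h2.
have [|x] := @IVT _ f u v y uv (continuous_subspaceT cf).
  by rewrite min_l // max_r // h1 h2.
by rewrite in_itv /=; exists x.
Qed.

Lemma ivt_decreasing f u v y : continuous f -> u <= v -> f v <= y <= f u ->
  exists2 x, u <= x <= v & f x = y.
Proof.
move=> cf uv /andP[h1 h2]; have fuv := le_trans h1 h2.
have [|x] := @IVT _ f u v y uv (continuous_subspaceT cf).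
  by rewrite min_r // max_l // h1 h2.
by rewrite in_itv /=; exists x.
Qed.

Lemma continuous_iter f n : continuous f -> continuous (iter n f).
Proof.
move=> cf; elim: n => [|n IH] x; first exact: cvg_id.
by apply: continuous_comp; [exact: IH|exact: cf].
Qed.

Lemma iter_stable (A : set R) f n x : (forall y, A y -> A (f y)) -> A x ->
  A (iter n f x).
Proof. by move=> AA Ax; elim: n => //= n; exact: AA. Qed.

Lemma iter_fixed f n x : f x = x -> iter n f x = x.
Proof. by move=> fx; elim: n => //= n ->. Qed.

Lemma pos_min f u v : continuous f -> u <= v ->
  (forall x, u <= x <= v -> 0 < f x) ->
  exists2 d, 0 < d & forall x, u <= x <= v -> d <= f x.
Proof.
move=> cf uv fpos; have [z zuv zmin] := EVT_min uv (continuous_subspaceT cf).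
exists (f z); first by apply: fpos; rewrite in_itv in zuv.
by move=> x xuv; apply: zmin; rewrite in_itv.
Qed.

Lemma archimedean_gt (x d : R) : 0 < d -> exists n : nat, x < n%:R * d.
Proof.
move=> d0; exists (Num.truncn (x / d)).+1.
by rewrite -ltr_pdivrMr //; exact: truncnS_gt.
Qed.

(** By compactness the height [h] drops by at least a fixed amount at each step as long as it is at
    least [e]. *)
Lemma uniform_descent f h u v e : continuous f -> continuous h -> u <= v ->
  (forall x, u <= x <= v -> u <= f x <= v) ->
  (forall x, u <= x <= v -> e <= h x -> h (f x) < h x) ->
  (forall x, u <= x <= v -> h x < e -> h (f x) < e) ->
  exists k, forall x, u <= x <= v -> h (iter k f x) < e.
Proof.
move=> cf ch uv fuv hdec hlow.
(* This maximum is positive on all of [[u, v]], hence at least some [d > 0]. Where [e <= h x] its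
   second entry is not positive, so there the drop of [h] is at least [d]. *)
have [|x xuv|d d0 hd] :=
  @pos_min (fun x => Num.max (h x - h (f x)) (e - h x)) u v _ uv.
- move=> x.
  apply: (@continuous_max R R (fun x => h x - h (f x)) (fun x => e - h x)).
    apply: cvgB; first exact: ch.
    by apply: continuous_comp; [exact: cf|exact: ch].
  by apply: cvgB; [exact: cvg_cst|exact: ch].
- rewrite lt_max !subr_gt0; have [he|he] := ltP (h x) e.
    by rewrite orbT.
  by rewrite hdec.
have [m _ hm] := EVT_max uv (continuous_subspaceT ch).
have [k hk] := archimedean_gt (h m - e) d0; exists k => x xuv.
have stab n : u <= iter n f x <= v.
  exact: (@iter_stable [set x | u <= x <= v]).
have [//|/le_lt_trans] : h (iter k f x) < e \/ h (iter k f x) <= h x - k%:R * d.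
  elim: (k) => [|n [IH|IH]]; first by right; rewrite mul0r subr0.
    by left; rewrite iterS; exact: (hlow _ (stab n)).
  have [he|he] := ltP (h (iter n f x)) e.
    by left; exact: (hlow _ (stab n)).
  have := hd _ (stab n); rewrite le_max => /orP[hx|hx]; last first.
    by exfalso; lra.
  by right; rewrite iterS -natr1 mulrDl mul1r; lra.
by apply; have := hm x; rewrite in_itv /= => /(_ xuv) ?; lra.
Qed.

Lemma climb f w d : continuous f -> w <= d ->
  (forall x, w <= x <= d -> x < f x) -> exists n, d <= iter n f w.
Proof.
move=> cf wd fgt.
have [x|x xwd|g g0 hg] := @pos_min (fun x => f x - x) w d _ wd.
- by apply: cvgB; [exact: cf|exact: cvg_id].
- by rewrite subr_gt0 fgt.
have [k hk] := archimedean_gt (d - w) g0.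
apply: contrapT => /forallNP no.
have no' n : iter n f w < d by rewrite ltNge; apply/negP; exact: no.
suff : w + k%:R * g <= iter k f w by have := no' k; lra.
elim: (k) => [|n IH]; first by rewrite mul0r addr0.
have := hg (iter n f w); rewrite iterS -natr1 mulrDl mul1r => h.
have : w <= iter n f w <= d.
  rewrite (ltW (no' n)) andbT; apply: le_trans IH.
  by rewrite lerDl mulr_ge0 // ltW.
by move=> /h; lra.
Qed.

(** Some iterate fixes [u] and sends [w] to [d] or beyond, so it takes the value [d] on [[u, w]]. *)
Lemma climb_hit f u w d : continuous f -> f u = u -> u < w -> u <= d ->
  (forall x, u < x <= d -> x < f x) ->
  exists n x, u <= x <= w /\ iter n f x = d.
Proof.
move=> cf fu uw ud fgt.
have [dw|wd] := leP d w; first by exists 0%N, d; rewrite ud dw.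
have [|x /andP[wx xd]|n hn] := @climb f w d cf; first exact: ltW.
  by apply: fgt; rewrite xd andbT; apply: lt_le_trans wx.
have [||x xuw hx] := @ivt_increasing (iter n f) u w d (continuous_iter cf).
- exact: ltW.
- by rewrite iter_fixed // ud hn.
- by exists n, x.
Qed.

(** The distance to [q] serves as height: after a bounded time all orbits stay within [e / 2] of [q]
    and are no longer separated. *)
Lemma pol_upper_contract f u v q e : 0 < e -> continuous f -> u <= v ->
  (forall x, u <= x <= v -> u <= f x <= v) ->
  (forall x, u <= x <= v -> x != q -> `|f x - q| < `|x - q|) -> f q = q ->
  pol_upper 0 f `[u, v] e.
Proof.
move=> e0 cf uv fuv hq fq.
have step x : u <= x <= v -> `|x - q| < e / 2 -> `|f x - q| < e / 2.
  move=> xuv; have [->|xq] := eqVneq x q; first by rewrite fq.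
  by apply: lt_trans; exact: hq.
have [|x xuv ex||k hk] :=
  @uniform_descent f (fun x => `|x - q|) u v (e / 2) cf _ uv fuv.
- move=> x; apply: (@continuous_comp _ _ _ (fun x => x - q) Num.norm);
    last exact: norm_continuous.
  by apply: cvgB; [exact: cvg_id|exact: cvg_cst].
- apply: hq => //; apply: contraTneq ex => ->.
  by rewrite subrr normr0 -ltNge divr_gt0.
- exact: step.
pose B := [set x | u <= x <= v /\ `|x - q| < e / 2].
apply: (@pol_upper_iter _ _ _ _ B u v e k) => //.
- move=> x /=; rewrite in_itv /= => xuv; split; last exact: hk.
  exact: (@iter_stable [set x | u <= x <= v]).
exists 1%N => n; rewrite mul1n expn0; apply: sep_bound_small => i x y _ Bx By.
have BB z : B z -> B (f z) by case=> zuv zq; split; [exact: fuv|exact: step].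
have [_ hx] := iter_stable i BB Bx; have [_ hy] := iter_stable i BB By.
have -> : iter i f x - iter i f y = (iter i f x - q) - (iter i f y - q) by ring.
by rewrite (le_trans (ler_normB _ _)) //; lra.
Qed.

End ContinuousIteration.

(** * Cross-ratios and renormalization *)

(** The product of the lengths of the whole and of the middle interval over that of the two side
    intervals. It is invariant under reversal of the four points, so it serves on decreasing laps
    too. *)
Definition cross_ratio (R : realType) (x1 x2 x3 x4 : R) : R :=
  (x3 - x2) * (x4 - x1) / ((x2 - x1) * (x4 - x3)).

(** Maps of negative Schwarzian derivative have this property on each lap; this form avoids
    derivatives and passes to compositions. *)
Definition expands_cross_ratio (R : realType) (T : R -> R) (l r : R) : Prop :=
  forall x1 x2 x3 x4, l <= x1 -> x1 < x2 -> x2 < x3 -> x3 < x4 -> x4 <= r ->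
  cross_ratio x1 x2 x3 x4 < cross_ratio (T x1) (T x2) (T x3) (T x4).

Section CrossRatio.
Context {R : realType}.
Implicit Types (T : R -> R) (l r x y w s t p : R).

Lemma cross_ratio_rev x1 x2 x3 x4 :
  cross_ratio x4 x3 x2 x1 = cross_ratio x1 x2 x3 x4 :> R.
Proof. by rewrite /cross_ratio; congr (_ / _); ring. Qed.

Lemma expands_iter2_dec T l r l' r' :
  (forall x y, l <= x -> x < y -> y <= r -> T y < T x) ->
  (forall x, l <= x <= r -> l' <= T x <= r') ->
  expands_cross_ratio T l r -> expands_cross_ratio T l' r' ->
  expands_cross_ratio (iter 2 T) l r.
Proof.
move=> dec im h h' x1 x2 x3 x4 l1 h12 h23 h34 r4.
apply: lt_trans (h _ _ _ _ l1 h12 h23 h34 r4) _.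
have /im/andP[_ ?] : l <= x1 <= r by lra.
have /im/andP[? _] : l <= x4 <= r by lra.
rewrite -cross_ratio_rev -[X in _ < X]cross_ratio_rev.
by apply: h' => //; apply: dec; lra.
Qed.

Lemma cross_ratio_shrink w s s' t' t y :
  w < s -> s <= s' -> s' < t' -> t' <= t -> t < y ->
  cross_ratio w s' t' y <= cross_ratio w s t y.
Proof.
move=> ws ss st tt ty; rewrite /cross_ratio ler_pM //.
- by rewrite mulr_ge0 //; lra.
- by rewrite invr_ge0 mulr_ge0 //; lra.
- by rewrite ler_wpM2r //; lra.
- rewrite lef_pV2 ?posrE ?mulr_gt0 //; try lra.
  by apply: ler_pM; lra.
Qed.

Lemma cross_ratio_far w p y s s' : w < p -> p < y -> y < s -> s <= s' ->
  cross_ratio w p y s' <= cross_ratio w p y s.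
Proof.
move=> wp py ys ss; rewrite /cross_ratio.
rewrite ler_pdivrMr ?mulr_gt0 ?subr_gt0 //; last exact: lt_le_trans ss.
rewrite mulrAC ler_pdivlMr ?mulr_gt0 ?subr_gt0 //.
have -> : (y - p) * (s' - w) * ((p - w) * (s - y)) =
  (y - p) * (p - w) * ((s' - w) * (s - y)) by ring.
have -> : (y - p) * (s - w) * ((p - w) * (s' - y)) =
  (y - p) * (p - w) * ((s - w) * (s' - y)) by ring.
rewrite ler_wpM2l ?mulr_ge0 ?subr_ge0 ?(ltW wp) ?(ltW py) //.
have : 0 <= (s' - s) * (y - w) by rewrite mulr_ge0 // subr_ge0 //; lra.
by nra.
Qed.

End CrossRatio.

(** The bound [T c <= b] is kept apart: the square on [[p, b1]] has to be recognized as unimodal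
    before its invariance is decided. *)
Record unimodal (R : realType) (T : R -> R) (a c b : R) : Prop := Unimodal {
  um_cont : continuous T;
  um_lip : exists2 L : R, 0 < L &
    forall x y, a <= x <= b -> a <= y <= b -> `|T x - T y| <= L * `|x - y|;
  um_ac : a < c;
  um_cb : c < b;
  um_Ta : T a = a;
  um_Tb : T b = a;
  um_inc : forall x y, a <= x -> x < y -> y <= c -> T x < T y;
  um_dec : forall x y, c <= x -> x < y -> y <= b -> T y < T x;
  um_crl : expands_cross_ratio T a c;
  um_crr : expands_cross_ratio T c b }.

Definition fixed_dichotomy (R : realType) (T : R -> R) (a b : R) : Prop :=
  (forall x, a < x <= b -> T x < x) \/
  exists p, [/\ a < p < b, T p = p, forall x, a < x < p -> x < T x &
    forall x, p < x <= b -> T x < x].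

(* T maps [p, b1] onto [q, p], and c1 is the critical point there of the square
   of T; that square leaves [p, b1] invariant if and only if T c <= b1. *)
Record restrictive (R : realType) (T : R -> R) (a c b p q c1 b1 : R) : Prop :=
  Restrictive {
  re_Tcb : T c <= b; re_cp : c < p; re_pb : p < b; re_Tp : T p = p;
  re_aq : a < q; re_qc : q < c; re_Tq : T q = p;
  re_pc1 : p < c1; re_Tc1 : T c1 = c;
  re_cb1 : c1 < b1; re_b1b : b1 < b; re_Tb1 : T b1 = q }.

(** * Unimodal maps and their squares *)

Section Unimodal.
Context {R : realType}.
Variables (T : R -> R) (a c b : R).
Hypothesis uT : unimodal T a c b.
Implicit Types (p x y z v : R) (n m : nat).

Let cT : continuous T. Proof. exact: um_cont uT. Qed.
Let Ta := um_Ta uT.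
Let Tb := um_Tb uT.
Let inc := um_inc uT.
Let dec := um_dec uT.

Lemma um_inc_le x y : a <= x -> x <= y -> y <= c -> T x <= T y.
Proof.
have [ac cb] := (um_ac uT, um_cb uT).
move=> ax; rewrite le_eqVlt => /predU1P[->//|xy] yc; exact/ltW/inc.
Qed.

Lemma um_dec_le x y : c <= x -> x <= y -> y <= b -> T y <= T x.
Proof.
have [ac cb] := (um_ac uT, um_cb uT).
move=> cx; rewrite le_eqVlt => /predU1P[->//|xy] yb; exact/ltW/dec.
Qed.

Lemma um_image x : a <= x <= b -> a <= T x <= T c.
Proof.
have [ac cb] := (um_ac uT, um_cb uT).
move=> /andP[ax xb]; have [xc|/ltW cx] := leP x c.
  by rewrite -{1}Ta !um_inc_le.
by rewrite -{1}Tb !um_dec_le.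
Qed.

(* If the image of [a, c] covers [a, b], then the preimages of c accumulate at
   b, and each of them yields a periodic point close to b. *)
Lemma horseshoe v : (forall x, a < x <= c -> x < T x) -> b <= T c -> v < b ->
  exists z m, [/\ v < z < b, a <= z, (0 < m)%N & iter m T z = z].
Proof.
have [ac cb] := (um_ac uT, um_cb uT).
move=> Tgt bTc vb.
have [v' [vv' cv' v'b]] : exists v', [/\ v < v', c < v' & v' < b].
  have vcb : Num.max v c < b by rewrite gt_max vb cb.
  have [vm cm] : v <= Num.max v c /\ c <= Num.max v c.
    by rewrite !le_max !lexx orbT.
  by exists ((Num.max v c + b) / 2); split; lra.
have aTv : a < T v' by rewrite -Tb; apply: dec => //; exact: ltW.
have [n [x [/andP[ax xv] hx]]] := climb_hit cT Ta aTv (ltW ac) Tgt.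
have [|u /andP[v'u ub] Tu] := ivt_decreasing cT (ltW v'b) (y := x).
  by rewrite Tb ax xv.
(* This iterate sends [b] to [a] and [u] to [T c], which is at least [b]; hence it has a fixed point
   between [u] and [b]. *)
have hb : iter n.+2 T b = a by rewrite iterSr Tb iter_fixed.
have hu : iter n.+2 T u = T c by rewrite iterSr Tu iterS hx.
have cn := continuous_iter (n := n.+2) cT.
have [||z /andP[uz zb] /eqP] :=
  @ivt_decreasing _ (fun x => iter n.+2 T x - x) u b 0 _ ub.
- by move=> y; exact: (cvgB (cn y) cvg_id).
- by rewrite hb hu subr_ge0 subr_le0 (ltW (lt_trans ac cb)) (le_trans ub bTc).
rewrite subr_eq0 => /eqP hz; exists z, n.+2; split => //.
- apply/andP; split; first by lra.
  rewrite lt_neqAle zb andbT; apply/eqP => zE.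
  by move: hz; rewrite zE hb => ab; move: ac cb; rewrite -ab; lra.
- by lra.
Qed.

Lemma iter2_inc p q c1 b1 x y : restrictive T a c b p q c1 b1 ->
  p <= x -> x < y -> y <= c1 -> iter 2 T x < iter 2 T y.
Proof.
have [ac cb] := (um_ac uT, um_cb uT).
move=> [? cp pb Tp aq qc Tq pc1 Tc1 cb1 b1b Tb1] px xy yc.
have h : T y < T x by apply: dec; lra.
have : T x <= T p by apply: um_dec_le; lra.
have : T c1 <= T y by apply: um_dec_le; lra.
by rewrite Tp Tc1 /= => ? ?; apply: dec; lra.
Qed.

Lemma iter2_dec p q c1 b1 x y : restrictive T a c b p q c1 b1 ->
  c1 <= x -> x < y -> y <= b1 -> iter 2 T y < iter 2 T x.
Proof.
have [ac cb] := (um_ac uT, um_cb uT).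
move=> [? cp pb Tp aq qc Tq pc1 Tc1 cb1 b1b Tb1] px xy yc.
have h : T y < T x by apply: dec; lra.
have : T x <= T c1 by apply: um_dec_le; lra.
have : T b1 <= T y by apply: um_dec_le; lra.
by rewrite Tb1 Tc1 /= => ? ?; apply: inc; lra.
Qed.

(** [T] maps [[p, c1]] onto [[c, p]] and [[c1, b1]] onto [[q, c]], reversing order. The first image
    lies in the decreasing lap of [T] and the second in the increasing one. *)
Lemma unimodal_iter2 p q c1 b1 : restrictive T a c b p q c1 b1 ->
  unimodal (iter 2 T) p c1 b1.
Proof.
have [ac cb] := (um_ac uT, um_cb uT).
move=> re; have [? cp pb Tp aq qc Tq pc1 Tc1 cb1 b1b Tb1] := re.
split => //; first exact: continuous_iter.
- have [L L0 hL] := um_lip uT; exists (L * L); first by rewrite mulr_gt0.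
  have im z : p <= z <= b1 -> a <= T z <= b.
    move=> hz; have : T b1 <= T z by apply: um_dec_le; lra.
    have : T z <= T p by apply: um_dec_le; lra.
    by rewrite Tb1 Tp; lra.
  move=> x y hx hy; apply: le_trans (hL _ _ (im _ hx) (im _ hy)) _.
  by rewrite -mulrA ler_wpM2l ?(ltW L0) //; apply: hL; lra.
- by rewrite iter_fixed.
- by rewrite /= Tb1.
- by move=> x y; exact: iter2_inc re.
- by move=> x y; exact: iter2_dec re.
- apply: (@expands_iter2_dec _ _ _ _ c b); last exact: um_crr uT.
  + by move=> x y ? ? ?; apply: dec; lra.
  + move=> x hx; have : T c1 <= T x by apply: um_dec_le; lra.
    have : T x <= T p by apply: um_dec_le; lra.
    by rewrite Tc1 Tp; lra.
  + by move=> x1 x2 x3 x4 ? ? ? ? ?; apply: (um_crr uT) => //; lra.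
- apply: (@expands_iter2_dec _ _ _ _ a c); last exact: um_crl uT.
  + by move=> x y ? ? ?; apply: dec; lra.
  + move=> x hx; have : T b1 <= T x by apply: um_dec_le; lra.
    have : T x <= T c1 by apply: um_dec_le; lra.
    by rewrite Tc1 Tb1; lra.
  + by move=> x1 x2 x3 x4 ? ? ? ? ?; apply: (um_crr uT) => //; lra.
Qed.

(** A fixed point [y] of the square in [(p, c1]] comes with a fixed point [T y < p], and then the
    expansion of cross-ratios around [p] leaves no room for another one. Without such a [y], the
    position of the critical value relative to [c1] decides, as the square decreases beyond [c1]. *)
Lemma fixed_dichotomy_iter2 p q c1 b1 : restrictive T a c b p q c1 b1 ->
  fixed_dichotomy (iter 2 T) p b1.
Proof.
have [ac cb] := (um_ac uT, um_cb uT).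
move=> re; have [Tcb cp pb Tp aq qc Tq pc1 Tc1 cb1 b1b Tb1] := re.
set g := iter 2 T.
have cg : continuous g := continuous_iter (n := 2) cT.
have cgB : continuous (fun x => g x - x).
  by move=> x; exact: (cvgB (cg x) cvg_id).
have gp : g p = p by rewrite /g iter_fixed.
have gb1 : g b1 = p by rewrite /g /= Tb1.
have gi x y : p <= x -> x < y -> y <= c1 -> g x < g y by exact: iter2_inc re.
have gd x y : c1 <= x -> x < y -> y <= b1 -> g y < g x by exact: iter2_dec re.
(* The interval has [p] in its interior, and [T] maps it into the decreasing lap. *)
have X : expands_cross_ratio g c c1.
  apply: (@expands_iter2_dec _ _ _ _ c b); last exact: um_crr uT.
  - by move=> x y ? ? ?; apply: dec; lra.
  - move=> x hx; have : T c1 <= T x by apply: um_dec_le; lra.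
    have : T x <= T c by apply: um_dec_le; lra.
    by rewrite Tc1; lra.
  - by move=> x1 x2 x3 x4 ? ? ? ? ?; apply: (um_crr uT) => //; lra.
have [[y [py yc gy]]|nofix] :=
  pselect (exists y, [/\ p < y, y <= c1 & g y = y]).
  pose w := T y.
  have wp : w < p by rewrite -[X in _ < X]Tp; apply: dec; lra.
  have cw : c <= w by rewrite -Tc1; apply: um_dec_le; lra.
  have gw : g w = w by rewrite /g /w -[in RHS]gy.
  (* Otherwise, of the four points [w < T t < t < y], the outer two are fixed by [g] and the inner
     two do not move apart, so that the cross-ratio does not grow. *)
  have gt t : p < t < y -> t < g t.
    move=> /andP[pt ty]; rewrite ltNge; apply/negP => gt.
    have wT : w < T t by apply: dec; lra.
    have Tt : T t < p by rewrite -[X in _ < X]Tp; apply: dec; lra.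
    have pg : p < g t by rewrite -gp; apply: gi; lra.
    have Tgt : T (g t) < p by rewrite -[X in _ < X]Tp; apply: dec; lra.
    have gs : T t <= g (T t) by rewrite /g /=; apply: (@um_dec_le (g t) t); lra.
    have gs' : g (T t) < p by [].
    have tp : T t < t by lra.
    have := X w (T t) t y cw wT tp ty yc.
    by rewrite gw gy ltNge cross_ratio_shrink //; lra.
  (* Otherwise [g] fixes the first three of the points [w < p < y < s] and does not move [s] to the
     left, so that the cross-ratio does not grow. *)
  have lt s : y < s <= c1 -> g s < s.
    move=> /andP[ys sc]; rewrite ltNge; apply/negP => gs.
    have := X w p y s cw wp py ys sc.
    by rewrite gw gp gy ltNge cross_ratio_far.
  have gc : g c1 <= c1.
    have [yc1|c1y] := ltP y c1; first by apply/ltW/lt; lra.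
    have <- : y = c1; [by lra|by rewrite gy].
  right; exists y; split => //; first by lra.
  move=> x hx; have [xc|cx] := leP x c1; first by apply: lt; lra.
  by have := gd c1 x (lexx _) cx; lra.
have [gc|gc] := leP (g c1) c1.
  left => x hx; have [xc|cx] := leP x c1; last first.
    by have := gd c1 x (lexx _) cx; lra.
  rewrite ltNge; apply/negP => gx; apply: nofix.
  have [|z hz /eqP] := ivt_decreasing cgB xc (y := 0); first by lra.
  by rewrite subr_eq0 => /eqP gz; exists z; split => //; lra.
have [||z hz /eqP] := ivt_decreasing cgB (u := c1) (v := b1) (y := 0);
  try by lra.
rewrite subr_eq0 => /eqP gz.
have cz : c1 < z.
  rewrite lt_neqAle; apply/andP; split; last by lra.
  by apply/eqP => zc; move: gz; rewrite -zc; lra.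
have zb : z < b1.
  rewrite lt_neqAle; apply/andP; split; last by lra.
  by apply/eqP => zc; move: gz; rewrite zc; lra.
right; exists z; split => //; first by lra.
  move=> x hx; have [xc|cx] := leP x c1; last by have := gd x z; lra.
  rewrite ltNge; apply/negP => gx; apply: nofix.
  have [|t ht /eqP] := ivt_increasing cgB xc (y := 0); first by lra.
  by rewrite subr_eq0 => /eqP gt; exists t; split => //; lra.
by move=> x hx; have := gd z x; lra.
Qed.

Lemma restrictive_exists p : T c <= b -> c < p < b -> T p = p ->
  exists q c1 b1, restrictive T a c b p q c1 b1.
Proof.
have [ac cb] := (um_ac uT, um_cb uT).
move=> Tcb /andP[cp pb] Tp.
have pTc : p < T c by rewrite -[X in X < _]Tp; apply: dec; lra.
have [|q hq Tq] := ivt_increasing cT (ltW ac) (y := p).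
  by rewrite Ta; lra.
have aq : a < q.
  rewrite lt_neqAle; apply/andP; split; last by lra.
  by apply/eqP => qE; move: Tq; rewrite -qE Ta; lra.
have qc : q < c.
  rewrite lt_neqAle; apply/andP; split; last by lra.
  by apply/eqP => qE; move: Tq; rewrite qE; lra.
have [|c1 hc1 Tc1] := ivt_decreasing cT (ltW pb) (y := c).
  by rewrite Tb Tp; lra.
have pc1 : p < c1.
  rewrite lt_neqAle; apply/andP; split; last by lra.
  by apply/eqP => qE; move: Tc1; rewrite -qE Tp; lra.
have [||b1 hb1 Tb1] := ivt_decreasing cT (u := c1) (v := b) (y := q).
- by lra.
- by rewrite Tb Tc1; lra.
have cb1 : c1 < b1.
  rewrite lt_neqAle; apply/andP; split; last by lra.
  by apply/eqP => qE; move: Tb1; rewrite -qE; lra.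
have b1b : b1 < b.
  rewrite lt_neqAle; apply/andP; split; last by lra.
  by apply/eqP => qE; move: Tb1; rewrite qE Tb; lra.
by exists q, c1, b1.
Qed.

End Unimodal.

(** If [b1 <= T c], the square has a horseshoe on [[p, b1]] and its periodic points accumulate at
    [b1], so no finite list [s] contains them all. *)
Lemma restrictive_invariant (R : realType) (T : R -> R) a c b p q c1 b1
    (s : seq R) :
  unimodal T a c b -> restrictive T a c b p q c1 b1 ->
  (forall x m, a <= x <= b -> (0 < m)%N -> iter m T x = x -> x \in s) ->
  T c < b1.
Proof.
move=> uT re per; have [ac cb] := (um_ac uT, um_cb uT).
have [Tcb cp pb Tp aq qc Tq pc1 Tc1 cb1 b1b Tb1] := re.
rewrite ltNge; apply/negP => b1T.
have gc : iter 2 T c1 = T c by rewrite /= Tc1.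
have [gt|[p1 [hp1 gp1 gt lt]]] := fixed_dichotomy_iter2 uT re.
  by have := gt c1; rewrite gc; lra.
have c1p : c1 < p1.
  rewrite ltNge le_eqVlt; apply/negP => /predU1P[p1c|p1c].
    by move: gp1; rewrite p1c gc; lra.
  by have := lt c1; rewrite gc; lra.
(* No element of [s] lies strictly between [v] and [b1], but the horseshoe has a periodic point
   there. *)
pose v := \big[Num.max/c1]_(x <- s | x < b1) x.
have vb : v < b1.
  by rewrite /v; elim/big_ind: _ => // x y; rewrite gt_max => -> ->.
have [||z [m [/andP[vz zb] pz m0 hz]]] :=
  horseshoe (unimodal_iter2 uT re) _ _ vb.
- by move=> x hx; apply: gt; lra.
- by rewrite gc.
have zs : z \in s.
  apply: (per z m.*2); first by lra.
    by rewrite double_gt0.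
  by rewrite -iter2_double.
move: vz; rewrite ltNge => /negP; apply.
exact: (@le_bigmax_seq _ _ _ s c1 z (fun x => x < b1) id zs zb).
Qed.

(* Arbitrarily close to the orbit of q there are points whose trajectories
   accumulate away from that orbit. The condition a < z makes the property pass
   from the square of T on [p, b1] to T. *)
Definition escapes (R : realType) (T : R -> R) (a b q : R) : Prop :=
  forall U : set R, open U -> (forall j, U (iter j T q)) ->
  exists x z, [/\ U x, a <= x <= b, a < z <= b,
    exists2 e, 0 < e & forall j, e <= `|z - iter j T q| &
    forall e N, 0 < e -> exists2 n, (N <= n)%N & `|iter n T x - z| < e].

(** * Cycles that do not attract *)

Section Escape.
Context {R : realType}.
Implicit Types (T : R -> R) (a b c p q x y z : R) (n m k i j : nat).

Lemma escapes_not_attracting T a b q : escapes T a b q ->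
  ~ attracting_set `[a, b] T (forward_orbit T q).
Proof.
move=> esc [U [oU CU conv]].
have [|x [z [Ux xab _ [e e0 he] acc]]] := esc U oU.
  by move=> j; apply: CU; exists j.
have Ix : (U `&` `[a, b]) x by split=> //=; rewrite in_itv.
have e2 : 0 < e / 2 by rewrite divr_gt0.
have [N _ hN] := conv x Ix _ e2.
have [n Nn hn] := acc _ N e2.
have [_ [j _ <-] hj] := hN n Nn.
have := he j; rewrite leNgt => /negP; apply.
have -> : z - iter j T q = (iter n T x - iter j T q) - (iter n T x - z) by ring.
by rewrite (le_lt_trans (ler_normB _ _)) //; lra.
Qed.

Lemma open_right (U : set R) a p : open U -> U a -> a < p ->
  exists2 w, a < w < p & forall x, a <= x <= w -> U x.
Proof.
move=> oU Ua ap.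
have /nbhs_ballP[d /= d0 hd] : nbhs a U by exact: open_nbhs_nbhs.
have [m [m0 md mp]] : exists m : R, [/\ 0 < m, m <= d & m <= p - a].
  exists (Num.min d (p - a)); rewrite lt_min d0 subr_gt0 ap.
  by split=> //; rewrite ge_min lexx ?orbT.
exists (a + m / 2); first by lra.
move=> x hx; apply: hd; rewrite /ball /= distrC ger0_norm; lra.
Qed.

Lemma iter_lt (A : set R) T k q : (forall x, A x -> A (T x) /\ T x <= x) ->
  A q -> T q < q -> (0 < k)%N -> iter k T q < q.
Proof.
move=> hA Aq Tq; case: k => // k _; rewrite iterSr; apply: le_lt_trans Tq.
have ATq := (hA _ Aq).1; elim: k => //= k IH; apply: le_trans IH.
apply: (hA _ _).2; apply: iter_stable ATq => y /hA; tauto.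
Qed.

Lemma iter_gt (A : set R) T k q : (forall x, A x -> A (T x) /\ x <= T x) ->
  A q -> q < T q -> (0 < k)%N -> q < iter k T q.
Proof.
move=> hA Aq Tq; case: k => // k _; rewrite iterSr; apply: (lt_le_trans Tq).
have ATq := (hA _ Aq).1; elim: k => //= k IH; apply: (le_trans IH).
apply: (hA _ _).2; apply: iter_stable ATq => y /hA; tauto.
Qed.

Lemma iter_mul_fixed T k m q : iter k T q = q -> iter (m * k) T q = q.
Proof. by move=> hq; rewrite iterM iter_fixed. Qed.

Lemma iter_return T k i q : (0 < k)%N -> iter k T q = q ->
  exists r, iter r T (iter i T q) = q.
Proof.
move=> k0 hq; exists (i * k - i)%N.
by rewrite -iterD subnK ?iter_mul_fixed // leq_pmulr.
Qed.

Lemma least_period_iter T k i q : has_least_period T k q ->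
  has_least_period T k (iter i T q).
Proof.
move=> [k0 hq min]; split=> // [|j jk hj].
  by rewrite -iterD addnC iterD hq.
have [r hr] := iter_return i k0 hq.
apply: (min j jk).
have -> : iter j T q = iter r T (iter j T (iter i T q)).
  by rewrite -{1}hr -!iterD (addnC j).
by rewrite hj hr.
Qed.

Lemma least_period_fixed T k q : has_least_period T k q -> T q = q -> k = 1%N.
Proof.
move=> [k0 _ min] Tq; apply/eqP; rewrite eqn_leq k0 andbT leqNgt.
by apply/negP => k1; apply: (min 1%N).
Qed.

Lemma least_period_iter2 T k q : has_least_period T k.*2 q ->
  has_least_period (iter 2 T) k q.
Proof.
move=> [k0 hq min]; split; first by rewrite -double_gt0.
  by rewrite iter2_double.
move=> j jk; rewrite iter2_double; apply: min.
by rewrite double_gt0 ltn_double.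
Qed.

(** Seen from [iter i T q], the even iterates stay away from [z] by assumption, and the odd ones lie
    in the image of [[p, b1]], at or below [p], hence at distance at least [z - p]. *)
Lemma escapes_iter2 T a c b p q' c1 b1 q i k : unimodal T a c b ->
  restrictive T a c b p q' c1 b1 -> T c < b1 -> (0 < k)%N -> iter k T q = q ->
  p <= iter i T q <= b1 -> escapes (iter 2 T) p b1 (iter i T q) ->
  escapes T a b q.
Proof.
move=> uT re Tcb k0 hq pq esc U oU hU.
have uT2 := unimodal_iter2 uT re.
have [ac cb] := (um_ac uT, um_cb uT).
have [_ cp pb Tp aq qc Tq pc1 Tc1 cb1 b1b Tb1] := re.
have [|x [z [Ux xpb zpb [e e0 he] acc]]] := esc U oU.
  by move=> j; rewrite iter2_double -iterD; exact: hU.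
have zp : 0 < z - p by lra.
exists x, z; split; [by []|by lra|by lra| |].
- exists (Num.min e (z - p)); first by rewrite lt_min e0.
  move=> j; have [r hr] := iter_return i k0 hq.
  rewrite ge_min -[in iter j T q]hr -iterD; set n := (j + r)%N.
  rewrite -(odd_double_half n) iterD -iter2_double.
  case: (odd n) => /=; last by rewrite he.
  apply/orP; right; set y := iter _ _ _.
  have [py yb] : p <= y /\ y <= b1.
    have [] : p <= y <= b1; last by move=> /andP.
    apply: (@iter_stable _ [set x | p <= x <= b1]) => // w /= hw.
    by have := um_image uT2 hw; rewrite /= Tc1; lra.
  have : T y <= T p by apply: (um_dec_le uT); lra.
  rewrite Tp => Typ; apply: le_trans (ler_norm _); lra.
- move=> d N d0; have [n Nn hn] := acc d N d0.
  exists n.*2; last by rewrite -iter2_double.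
  by rewrite (leq_trans Nn) // -addnn leq_addr.
Qed.

End Escape.

(** * The height of the cascade *)

(** [h] counts the repelling left ends; if it is 0, the left end itself attracts. The lower bound
    lives on [[a, T c]] because only these points have preimages, which the next pullback
    requires. *)
Definition cascade_height (R : realType) (T : R -> R) (a c b : R) (h : nat) :
    Prop :=
  [/\ forall e, 0 < e -> pol_upper h T `[a, b] e, pol_lower h T `[a, T c] &
    forall q k, a <= q <= b -> has_least_period T k q ->
    [\/ q = a /\ h = 0%N, [/\ q <> a, (0 < h)%N & k = (2 ^ h.-1)%N] |
        escapes T a b q]].

Section Cascade.
Context {R : realType}.
Implicit Types (T : R -> R) (a b c p q x y z : R) (n m k i j h : nat).

Lemma pol_upper_global_sink T a b e : continuous T -> a <= b -> T a = a ->
  (forall x, a <= x <= b -> a <= T x <= b) ->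
  (forall x, a < x <= b -> T x < x) -> 0 < e -> pol_upper 0 T `[a, b] e.
Proof.
move=> cT ab Ta Tab lt e0; apply: (@pol_upper_contract _ T a b a) => //.
move=> x /[dup] xab /Tab Txab xa.
have ax : a < x by rewrite lt_neqAle eq_sym xa; lra.
have := lt x; rewrite !ger0_norm; lra.
Qed.

Lemma cascade_height_sink T a c b : unimodal T a c b -> T c <= b ->
  (forall x, a < x <= b -> T x < x) -> cascade_height T a c b 0.
Proof.
move=> uT Tcb lt; have [ac cb] := (um_ac uT, um_cb uT); have Ta := um_Ta uT.
have Tab x : a <= x <= b -> a <= T x <= b by move=> /(um_image uT); lra.
split=> [e||q k qab [k0 hq _]].
- by apply: pol_upper_global_sink => //; [exact: um_cont uT|lra].
- apply: (@pol_lower0 _ _ _ a); rewrite /= in_itv /= lexx /=.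
  by have := um_image uT (x := c); lra.
- apply: Or31; split=> //; apply/eqP; apply: contraT => qa.
  have aq : a < q by rewrite lt_neqAle eq_sym qa; lra.
  suff : iter k T q < q by rewrite hq ltxx.
  apply: (@iter_lt _ [set x | a <= x <= b]) => //; last by apply: lt; lra.
  move=> x /= xab; split; first exact: Tab.
  have [->|xa] := eqVneq x a; first by rewrite Ta.
  by apply/ltW/lt; rewrite lt_neqAle eq_sym xa; lra.
Qed.

(** Trajectories that start just to the right of [a] increase to [p]. *)
Lemma escapes_left_end_monotone T a c b p : unimodal T a c b ->
  a < p <= c -> T p = p -> (forall x, a < x < p -> x < T x) ->
  escapes T a b a.
Proof.
move=> uT /andP[ap pc] Tp gt.
have [ac cb] := (um_ac uT, um_cb uT); have Ta := um_Ta uT.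
have inc := um_inc uT; have cT := um_cont uT.
have below x : a < x < p -> x < T x < p.
  by move=> /andP[ax xp]; rewrite gt ?ax //= -[X in _ < X]Tp; apply: inc; lra.
move=> U oU Uj.
have Ua : U a := Uj 0%N.
have [x /andP[ax xp] xU] := open_right oU Ua ap.
exists x, p; split; [by apply: xU; lra|lra|lra| |].
- by exists (p - a); [lra|move=> j; rewrite iter_fixed // ler_norm].
move=> e N e0.
have stab y : x <= y <= p -> x <= T y <= p.
  move=> hy; have [->|yp] := eqVneq y p; first by rewrite Tp; lra.
  have yp' : y < p by rewrite lt_neqAle yp; lra.
  by have := below y; lra.
have [|y hy he|y hy he|n hn] :=
    @uniform_descent _ T (fun y => p - y) x p e cT _ (ltW xp) stab.
- by move=> y; apply: cvgB; [exact: cvg_cst|exact: cvg_id].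
- by have := below y; lra.
- have [yp|yp] := eqVneq y p; first by rewrite yp Tp; lra.
  have yp' : y < p by rewrite lt_neqAle yp; lra.
  by have := below y; lra.
have hN : x <= iter N T x <= p.
  by apply: (@iter_stable _ [set y | x <= y <= p]) => //=; rewrite lexx ltW.
have hnN : x <= iter n T (iter N T x) <= p.
  exact: (@iter_stable _ [set y | x <= y <= p]).
exists (n + N)%N; first exact: leq_addl.
rewrite iterD distrC ger0_norm; last lra.
exact: hn.
Qed.

(** From [p <= c] follows [T c <= c], so after one step the dynamics is that of an increasing map
    with fixed points [a], which repels, and [p], which attracts the rest. *)
Lemma cascade_height_monotone T a c b p : unimodal T a c b -> T c <= b ->
  a < p <= c -> T p = p -> (forall x, a < x < p -> x < T x) ->
  (forall x, p < x <= b -> T x < x) -> cascade_height T a c b 1.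
Proof.
move=> uT Tcb /andP[ap pc] Tp gt lt.
have [ac cb] := (um_ac uT, um_cb uT); have Ta := um_Ta uT.
have inc := um_inc uT; have inc_le := um_inc_le uT; have cT := um_cont uT.
have im := um_image uT.
have Tcc : T c <= c.
  move: pc; rewrite le_eqVlt => /predU1P[<-|pc]; first by rewrite Tp.
  by apply/ltW/lt; lra.
have pTc : p <= T c by rewrite -[X in X <= _]Tp; apply: inc_le; lra.
have below x : a < x < p -> x < T x < p.
  by move=> /andP[ax xp]; rewrite gt ?ax //= -[X in _ < X]Tp; apply: inc; lra.
have above x : p < x <= c -> p < T x < x.
  by move=> xp; rewrite lt ?andbT; [rewrite -[X in X < _]Tp; apply: inc|]; lra.
split.
- move=> e e0; apply: (@pol_upper_image _ _ _ _ `[a, T c] a b) => //.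
  have [u [au up ue]] : exists u, [/\ a < u, u <= p & u <= a + e].
    exists (Num.min p (a + e)); rewrite lt_min ap ltrDl e0.
    by split=> //; rewrite ge_min lexx ?orbT.
  apply: (@pol_upper_escape _ _ _ _ a) => //.
  + by move=> x /=; rewrite in_itv /=; lra.
  + by move=> x /=; rewrite !in_itv /= => ?; apply: im; lra.
  apply: (@pol_upperS _ _ _ _ `[u, c]).
    by move=> x [] /=; rewrite !in_itv /=; lra.
  have near x : u <= x <= c ->
      [\/ x = p, x < T x < p /\ x < p | p < T x < x /\ p < x].
    move=> hx; have [xp|px|] := ltgtP x p; last by constructor 1.
    - by constructor 2; split => //; apply: below; lra.
    - by constructor 3; split => //; apply: above; lra.
  apply: (@pol_upper_contract _ T u c p) => //; first lra.
    by move=> x hx; case: (near x hx) => [->|[]|[]]; rewrite ?Tp; lra.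
  move=> x hx xp; case: (near x hx) => [xE|[? ?]|[? ?]].
  + by rewrite xE eqxx in xp.
  + by rewrite !ltr0_norm; lra.
  + by rewrite !gtr0_norm; lra.
(* Any point between [a] and [p] would do: its pullbacks along the increasing branch lie at or below
   [u < v]. *)
- pose v := (a + p) / 2; have [av vp] : a < v /\ v < p by rewrite /v; lra.
  have [||u hu Tu] := ivt_increasing cT (u := a) (v := p) (y := v).
  + by lra.
  + by rewrite Ta Tp; lra.
  have au : a < u.
    rewrite lt_neqAle; apply/andP; split; last lra.
    by apply/eqP => uE; move: Tu; rewrite -uE Ta; lra.
  have uv : u < v.
    have up : u < p.
      rewrite lt_neqAle; apply/andP; split; last lra.
      by apply/eqP => uE; move: Tu; rewrite uE Tp; lra.
    by rewrite -Tu; apply: gt; rewrite au.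
  have /choice[phi hphi] :
      forall y, exists x, a < y <= v -> a < x <= u /\ T x = y.
    move=> y; have [yv|] := boolP (a < y <= v); last by exists 0.
    have [||x hx Tx] := ivt_increasing cT (u := a) (v := u) (y := y).
    + by lra.
    + by rewrite Ta Tu; lra.
    exists x => _; split=> //.
    have xa : x <> a by move=> xa; move: Tx; rewrite xa Ta; lra.
    by rewrite lt_neqAle eq_sym; move/eqP: xa => ->; lra.
  apply: (@pol_lowerS _ _ _ [set y | a < y <= v]).
    by move=> y /=; rewrite in_itv /=; lra.
  apply: (@pol_lower_pullback _ _ _ _ [set v] phi u v) => //.
  + by move=> y /= /hphi[h1 h2]; split=> //; lra.
  + by move=> y /= ->; rewrite av lexx.
  + by move=> y /= ->.
  + exact: pol_lower0.
- move=> q k qab lp; have [k0 hq _] := lp.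
  have [->|qa] := eqVneq q a.
    apply: Or33; apply: (escapes_left_end_monotone uT _ Tp gt); lra.
  have aq : a < q by rewrite lt_neqAle eq_sym qa; lra.
  have qTc : q <= T c.
    have : a <= iter k.-1 T q <= b.
      apply: (@iter_stable _ [set x | a <= x <= b]) => // x /= /im; lra.
    by move=> /im; rewrite -iterS prednK // hq; lra.
  have [qp|pq|qp] := ltgtP q p.
  + suff : q < iter k T q by rewrite hq ltxx.
    apply: (@iter_gt _ [set x | a < x < p]) => //=; [|lra|by apply: gt; lra].
    by move=> x hx; have := below x hx; split; lra.
  + suff : iter k T q < q by rewrite hq ltxx.
    apply: (@iter_lt _ [set x | p < x <= c]) => //=; [|lra|by apply: lt; lra].
    by move=> x hx; have := above x hx; split; lra.
  + apply: Or32; split=> //; first exact/eqP.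
    by rewrite (least_period_fixed lp) // qp.
Qed.

End Cascade.

(** * One renormalization step *)

Section Step.
Context {R : realType}.
Variables (T : R -> R) (a c b p q c1 b1 : R) (h : nat).
Hypothesis uT : unimodal T a c b.
Hypothesis re : restrictive T a c b p q c1 b1.
Hypothesis Tcb1 : T c < b1.
Hypothesis gt : forall x, a < x < p -> x < T x.
Hypothesis lt : forall x, p < x <= b -> T x < x.
Hypothesis ch : cascade_height (iter 2 T) p c1 b1 h.

(** The time spent near [a] gives the extra factor. The points left over reach [[q, T c]] after a
    bounded time, and [[q, p]] is mapped into [[p, T c]], where the bound for the square applies. *)
Lemma pol_upper_step e : 0 < e -> pol_upper h.+1 T `[a, b] e.
Proof.
move=> e0; have [ac cb] := (um_ac uT, um_cb uT).
have [Tcb cp pb Tp aq qc Tq pc1 Tc1 cb1 b1b Tb1] := re.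
have [up _ _] := ch; have T1 := Tcb1; have g := gt; have l := lt.
have im := um_image uT; have im2 := um_image (unimodal_iter2 uT re).
have gc : iter 2 T c1 = T c by rewrite /= Tc1.
have pTc : p < T c by rewrite -[X in X < _]Tp; apply: (um_dec uT); lra.
(* Here [T c < b1] is essential, as [T] takes points beyond [b1] below [q]. *)
have qT x : q < x <= T c -> q < T x.
  move=> hx; have [xc|cx] := leP x c.
    by have := um_inc uT (x := q) (y := x); rewrite Tq; lra.
  have := um_dec uT (x := T c) (y := b1).
  have := um_dec_le uT (x := x) (y := T c).
  by rewrite Tb1; lra.
apply: (@pol_upper_image _ _ _ _ `[a, T c] a b) => //.
have [w [aw wq we]] : exists w, [/\ a < w, w <= q & w <= a + e].
  exists (Num.min q (a + e)); rewrite lt_min aq ltrDl e0.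
  by split=> //; rewrite ge_min lexx ?orbT.
apply: (@pol_upper_escape _ _ _ _ a) => //.
- by move=> x /=; rewrite in_itv /=; lra.
- by move=> x /=; rewrite !in_itv /= => hx; apply: im; lra.
apply: (@pol_upperS _ _ _ _ `[w, T c]).
  by move=> x [] /=; rewrite !in_itv /=; lra.
have stab x : w <= x <= T c -> w <= T x <= T c.
  move=> hx; have [xq|qx] := leP x q.
    by have := g x; have := im x; lra.
  by have := qT x; have := im x; lra.
(* With height [- x] and threshold [- q], descent below the threshold means climbing above [q]. *)
have [||x hx hq|x hx hq|k hk] :=
  @uniform_descent _ T (fun x => - x) w (T c) (- q) (um_cont uT) _ _ stab.
- by move=> x; apply: cvgN; exact: cvg_id.
- by lra.
- by have := g x; lra.
- by have := qT x; lra.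
apply: (@pol_upper_iter _ _ _ _ `[q, T c] a b e k) => //.
- by move=> x /=; rewrite !in_itv /=; lra.
- move=> x /=; rewrite !in_itv /= => hx; have := hk x hx.
  have : w <= iter k T x <= T c.
    exact: (@iter_stable _ [set y | w <= y <= T c]).
  lra.
have upb1 : pol_upper h T `[p, b1] e.
  have [L L0 lip] := um_lip uT.
  apply: (@pol_upper_iter2 _ _ _ _ L) => //.
  - by move=> x y /=; rewrite !in_itv /= => ? ?; apply: lip; lra.
  - by move=> x; rewrite /= !in_itv /= => /im2; rewrite gc /=; lra.
apply: (@pol_upperS _ _ _ _ (`[q, p] `|` `[p, T c])).
  move=> x /=; rewrite !in_itv /= => hx.
  by have [xp|px] := leP x p; [left|right]; lra.
have upTc : pol_upper h T `[p, T c] e.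
  by apply: pol_upperS upb1 => x /=; rewrite !in_itv /=; lra.
apply: pol_upper_union => //.
apply: (@pol_upper_image _ _ _ _ `[p, T c] a b) => //.
  by move=> x /=; rewrite !in_itv /=; lra.
move=> x /=; rewrite !in_itv /= => hx; have := im x.
have [xc|cx] := leP x c.
  by have := um_inc_le uT (x := q) (y := x); rewrite Tq; lra.
by have := um_dec_le uT (x := x) (y := p); rewrite Tp; lra.
Qed.

(** The increasing branch has an inverse on all of [[a, T c]] with values at most [c]; as [c < p],
    there is a gap below [[p, T c]], where the square provides separated sets. *)
Lemma pol_lower_step : pol_lower h.+1 T `[a, T c].
Proof.
have [ac cb] := (um_ac uT, um_cb uT); have Ta := um_Ta uT.
have [Tcb cp pb Tp aq qc Tq pc1 Tc1 cb1 b1b Tb1] := re.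
have [_ lo _] := ch.
have gc : iter 2 T c1 = T c by rewrite /= Tc1.
have pTc : p < T c by rewrite -[X in X < _]Tp; apply: (um_dec uT); lra.
have /choice[phi hphi] :
    forall y, exists x, a <= y <= T c -> a <= x <= c /\ T x = y.
  move=> y; have [yTc|] := boolP (a <= y <= T c); last by exists 0.
  have [|x hx Tx] := ivt_increasing (um_cont uT) (ltW ac) (y := y).
    by rewrite Ta.
  by exists x.
rewrite gc in lo.
apply: (@pol_lower_pullback _ _ _ _ `[p, T c] phi c p) => //.
- move=> y /=; rewrite !in_itv /= => /hphi[hx Tx]; split=> //; lra.
- by move=> y /=; rewrite !in_itv /=; lra.
- by move=> y /=; rewrite in_itv /= => /andP[].
- exact: pol_lower_iter2.
Qed.

(** Arbitrarily close to [a] there are points that hit [q] exactly and from then on stay at [p]. *)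
Lemma escapes_left_end : escapes T a b a.
Proof.
move=> U oU Uj; have Ua : U a := Uj 0%N; have g := gt.
have [ac cb] := (um_ac uT, um_cb uT); have Ta := um_Ta uT.
have [Tcb cp pb Tp aq qc Tq pc1 Tc1 cb1 b1b Tb1] := re.
have [w /andP[aw wq] wU] := open_right oU Ua aq.
have [x hx|n [x [hx hn]]] := climb_hit (um_cont uT) Ta aw (ltW aq).
  by apply: g; lra.
exists x, p; split; [exact: wU|lra|lra| |].
- by exists (p - a); [lra|move=> j; rewrite iter_fixed // ler_norm].
- move=> e N e0; exists (N + n.+1)%N; first exact: leq_addr.
  by rewrite iterD iterS hn Tq iter_fixed // subrr normr0.
Qed.

(** Below [q] the map moves points to the right, so a periodic orbit cannot stay there; from
    [[q, p]] the next step leads to [[p, T c]]. *)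
Lemma orbit_meets x k : a < x <= b -> (0 < k)%N -> iter k T x = x ->
  exists i, p <= iter i T x <= b1.
Proof.
move=> axb k0 hk; have g := gt.
have [ac cb] := (um_ac uT, um_cb uT); have Ta := um_Ta uT.
have [Tcb cp pb Tp aq qc Tq pc1 Tc1 cb1 b1b Tb1] := re.
have im := um_image uT.
have orb i : a < iter i T x <= T c.
  have iab j : a <= iter j T x <= b.
    apply: (@iter_stable _ [set y | a <= y <= b]) => /= [y /im|]; lra.
  have [r hr] := iter_return i k0 hk.
  have [k' kE] : exists k', k = k'.+1 by case: (k) k0 => // k' _; exists k'.
  have : iter i T x = T (iter (i + k') T x).
    by rewrite -iterS -addnS -kE iterD hk.
  have := im _ (iab (i + k')%N) => imx iE.
  have xa : iter i T x <> a.
    by move=> xa; move: hr; rewrite xa iter_fixed //; lra.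
  by rewrite lt_neqAle eq_sym; move/eqP: xa => ->; lra.
have T1 := Tcb1.
have [j jq] : exists j, q <= iter j T x.
  apply: contrapT => /forallNP no.
  have no' j : iter j T x < q by rewrite ltNge; apply/negP.
  suff : x < iter k T x by rewrite hk ltxx.
  apply: (@iter_gt _ [set iter j T x | j in setT]) => //.
  - move=> _ [j _ <-]; split; first by exists j.+1.
    by apply/ltW/g; have := orb j; have := no' j; lra.
  - by exists 0%N.
  - by apply: g; have := no' 0%N => /=; lra.
have [pj|jp] := leP p (iter j T x).
  by exists j; have := orb j; lra.
exists j.+1; have := orb j.+1; rewrite !iterS.
have [xc|cx] := leP (iter j T x) c.
  by have := um_inc_le uT (x := q) (y := iter j T x); rewrite Tq; lra.
by have := um_dec_le uT (x := iter j T x) (y := p); rewrite Tp; lra.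
Qed.

Lemma cascade_height_step : cascade_height T a c b h.+1.
Proof.
have [ac cb] := (um_ac uT, um_cb uT).
have [Tcb cp pb Tp aq qc Tq pc1 Tc1 cb1 b1b Tb1] := re.
have [_ _ per2] := ch.
split=> [e||x k xab lp]; [exact: pol_upper_step|exact: pol_lower_step|].
have [k0 hk _] := lp.
have [->|xa] := eqVneq x a; first exact/Or33/escapes_left_end.
have [|i yi] := orbit_meets _ k0 hk.
  by rewrite lt_neqAle eq_sym xa; lra.
have lpy := least_period_iter i lp.
have lift : escapes (iter 2 T) p b1 (iter i T x) -> escapes T a b x.
  exact: escapes_iter2 uT re Tcb1 k0 hk yi.
(* At [p] the period is 1, which is the value for height 1; if [h] is positive, [p] escapes. *)
have [yp|yp] := eqVneq (iter i T x) p.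
  have k1 := least_period_fixed lpy; rewrite yp in k1.
  have lp2 : has_least_period (iter 2 T) 1 p.
    by split=> //= [|[|j]] //; rewrite !Tp.
  rewrite yp in lift.
  have pint : p <= p <= b1 by lra.
  have [[_ h0]|[]//|esc] := per2 p 1%N pint lp2; last exact/Or33/lift.
  by apply: Or32; rewrite h0 (k1 Tp); split=> //; exact/eqP.
(* The square preserves [[p, b1]] and [T] maps it to the left of [p], so an odd period would force
   the point to be [p]. *)
have ek : ~~ odd k.
  apply/negP => ok; set y := iter i T x in lpy yi yp.
  have [_ hy _] := lpy; have im2 := um_image (unimodal_iter2 uT re).
  have T1 := Tcb1.
  have hz : p <= iter k./2 (iter 2 T) y <= b1.
    apply: (@iter_stable _ [set z | p <= z <= b1]) => // z /= /im2.
    by rewrite /= Tc1; lra.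
  have : T (iter k./2 (iter 2 T) y) <= T p by apply: (um_dec_le uT); lra.
  rewrite iter2_double -iterS -[k./2.*2.+1]/(true + k./2.*2)%N -ok.
  by rewrite odd_double_half hy Tp; move: yp; rewrite neq_lt; lra.
have kE : k = k./2.*2 by rewrite -[LHS]odd_double_half (negbTE ek).
rewrite kE in lpy.
have [[/eqP]|[_ h0 kh]|esc] := per2 _ _ yi (least_period_iter2 lpy).
- by rewrite (negbTE yp).
- apply: Or32; split=> //; first exact/eqP.
  by rewrite kE kh -muln2 -expnSr prednK.
- exact/Or33/lift.
Qed.

End Step.

(** Induction on the length of [s]: the fixed point [a] is in the list but outside [[p, b1]], so the
    square gets a shorter list. *)
Theorem cascade_height_exists (R : realType) (T : R -> R) (a c b : R)
    (s : seq R) : unimodal T a c b -> T c <= b -> fixed_dichotomy T a b ->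
  (forall x m, a <= x <= b -> (0 < m)%N -> iter m T x = x -> x \in s) ->
  exists h, cascade_height T a c b h.
Proof.
have [n] := ubnP (size s).
elim: n => // n IH in T a c b s *.
move=> sn uT Tcb [lt|[p [apb Tp gt lt]]] per.
  by exists 0%N; exact: cascade_height_sink.
have [ac cb] := (um_ac uT, um_cb uT).
have [pc|cp] := leP p c.
  by exists 1%N; apply: (@cascade_height_monotone _ _ _ _ _ p) => //; lra.
have [|q [c1 [b1 re]]] := restrictive_exists uT Tcb _ Tp; first by lra.
have Tcb1 := restrictive_invariant uT re per.
have [_ _ pb _ aq qc Tq pc1 Tc1 cb1 b1b Tb1] := re.
have as_ : a \in s by apply: (per a 1%N) => //; [lra|exact: um_Ta uT].
have [||||x m hx m0 hm|h ch] := IH (iter 2 T) p c1 b1 [seq x <- s | x != a].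
- rewrite size_filter -ltnS; apply: leq_trans sn; rewrite ltnS.
  rewrite -(count_predC (pred1 a) s) -[X in (X < _)%N]add0n ltn_add2r.
  by rewrite -has_count has_pred1.
- exact: (unimodal_iter2 uT re).
- by rewrite /= Tc1 ltW.
- exact: (fixed_dichotomy_iter2 uT re).
- rewrite mem_filter /= (per x m.*2) ?double_gt0 // -?iter2_double //; last lra.
  by rewrite andbT; apply/eqP => xa; move: hx; rewrite xa; lra.
- by exists h.+1; exact: (cascade_height_step uT re Tcb1 gt lt ch).
Qed.

(** * The logistic family *)

Section Logistic.
Context {R : realType}.
Implicit Types (lam x y l r : R).

Lemma logistic_continuous lam : continuous (logistic lam).
Proof.
move=> x; rewrite /logistic; apply: cvgM.
  by apply: cvgM; [exact: cvg_cst|exact: cvg_id].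
by apply: cvgB; [exact: cvg_cst|exact: cvg_id].
Qed.

Lemma logistic_sub lam x y :
  logistic lam x - logistic lam y = lam * ((x - y) * (1 - x - y)).
Proof. by rewrite /logistic; ring. Qed.

Lemma logistic_bound lam x : 0 <= lam <= 4 -> 0 <= x <= 1 ->
  0 <= logistic lam x <= 1.
Proof.
move=> hl hx; have x1 : 0 <= x * (1 - x) by rewrite mulr_ge0; lra.
have x4 : x * (1 - x) <= 1 / 4.
  rewrite -subr_ge0.
  have -> : 1 / 4 - x * (1 - x) = (x - 1 / 2) ^+ 2 by field.
  exact: sqr_ge0.
rewrite /logistic -mulrA mulr_ge0 //=; last lra.
have -> : 1 = 4 * (1 / 4) :> R by field.
by apply: ler_pM; lra.
Qed.

(** With [u1], ..., [u4] measured from the critical point, the cross-ratio is multiplied by [(u3 +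
    u2) * (u4 + u1) / ((u2 + u1) * (u4 + u3))]. Numerator minus denominator is
    [(u1 - u3) * (u2 - u4)], and the denominator is positive on one side of the critical point. *)
Lemma logistic_expands lam l r : 0 < lam -> r <= 1 / 2 \/ 1 / 2 <= l ->
  expands_cross_ratio (logistic lam) l r.
Proof.
move=> lam0 hlr x1 x2 x3 x4 h1 h12 h23 h34 h4.
rewrite /cross_ratio !logistic_sub.
pose u1 := 1 / 2 - x1; pose u2 := 1 / 2 - x2; pose u3 := 1 / 2 - x3.
pose u4 := 1 / 2 - x4.
have s21 : 0 < (u2 + u1) * (u4 + u3).
  rewrite /u1 /u2 /u3 /u4; case: hlr => hlr.
    by apply: mulr_gt0; lra.
  by rewrite nmulr_rgt0; lra.
have -> : 1 - x3 - x2 = u3 + u2 by rewrite /u2 /u3; field.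
have -> : 1 - x4 - x1 = u4 + u1 by rewrite /u1 /u4; field.
have -> : 1 - x2 - x1 = u2 + u1 by rewrite /u1 /u2; field.
have -> : 1 - x4 - x3 = u4 + u3 by rewrite /u3 /u4; field.
have n0 : 0 < (x3 - x2) * (x4 - x1) by rewrite mulr_gt0; lra.
have d0 : 0 < (x2 - x1) * (x4 - x3) by rewrite mulr_gt0; lra.
have l0 : lam != 0 by rewrite gt_eqF.
set N := (x3 - x2) * (x4 - x1) in n0 *; set D := (x2 - x1) * (x4 - x3) in d0 *.
have -> : lam * ((x3 - x2) * (u3 + u2)) * (lam * ((x4 - x1) * (u4 + u1))) =
  lam ^+ 2 * N * ((u3 + u2) * (u4 + u1)) by rewrite /N; ring.
have -> : lam * ((x2 - x1) * (u2 + u1)) * (lam * ((x4 - x3) * (u4 + u3))) =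
  lam ^+ 2 * D * ((u2 + u1) * (u4 + u3)) by rewrite /D; ring.
have L2 : 0 < lam ^+ 2 by rewrite exprn_gt0.
rewrite ltr_pdivlMr; last by rewrite mulr_gt0 // mulr_gt0.
rewrite mulrAC ltr_pdivrMr //.
have -> : N * (lam ^+ 2 * D * ((u2 + u1) * (u4 + u3))) =
  lam ^+ 2 * N * D * ((u2 + u1) * (u4 + u3)) by ring.
have -> : lam ^+ 2 * N * ((u3 + u2) * (u4 + u1)) * D =
  lam ^+ 2 * N * D * ((u3 + u2) * (u4 + u1)) by ring.
rewrite ltr_pM2l; last by rewrite mulr_gt0 // mulr_gt0.
rewrite -subr_gt0.
have -> : (u3 + u2) * (u4 + u1) - (u2 + u1) * (u4 + u3) =
  (u1 - u3) * (u2 - u4) by ring.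
by apply: mulr_gt0; rewrite /u1 /u2 /u3 /u4; lra.
Qed.

Lemma logistic_unimodal lam : 0 < lam <= 4 ->
  unimodal (logistic lam) 0 (1 / 2) 1.
Proof.
move=> hl; split; first exact: logistic_continuous.
- exists lam; first by lra.
  move=> x y hx hy; rewrite logistic_sub !normrM gtr0_norm; last lra.
  rewrite ler_pM2l; last lra.
  by rewrite ler_piMr // ler_norml; lra.
- by lra.
- by lra.
- by rewrite /logistic mulr0 mul0r.
- by rewrite /logistic subrr mulr0.
- by move=> x y *; rewrite -subr_gt0 logistic_sub !mulr_gt0 //; lra.
- move=> x y *; rewrite -subr_gt0 logistic_sub mulr_gt0 //; first lra.
  by rewrite nmulr_rgt0; lra.
- by apply: logistic_expands; [lra|left].
- by apply: logistic_expands; [lra|right].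
Qed.

Lemma logistic_gt lam x : 1 < lam -> 0 < x < 1 - lam^-1 -> x < logistic lam x.
Proof.
move=> l1 /andP[x0 xl]; rewrite -subr_gt0.
have -> : logistic lam x - x = x * lam * (1 - lam^-1 - x).
  by rewrite /logistic; field; lra.
by rewrite !mulr_gt0 //; lra.
Qed.

Lemma logistic_lt lam x : 1 < lam -> 1 - lam^-1 < x -> logistic lam x < x.
Proof.
move=> l1 xl; have li : lam^-1 < 1 by rewrite invf_lt1; lra.
rewrite -subr_gt0.
have -> : x - logistic lam x = x * lam * (x - (1 - lam^-1)).
  by rewrite /logistic; field; lra.
by rewrite !mulr_gt0 //; lra.
Qed.

Lemma logistic_fixed lam : lam != 0 ->
  logistic lam (1 - lam^-1) = 1 - lam^-1.
Proof. by move=> l0; rewrite /logistic; field. Qed.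

Lemma logistic_dichotomy lam : 1 < lam ->
  fixed_dichotomy (logistic lam) 0 1.
Proof.
move=> l1; right; exists (1 - lam^-1).
have li : lam^-1 < 1 by rewrite invf_lt1; lra.
have l0 : 0 < lam^-1 by rewrite invr_gt0; lra.
split=> [|||x /andP[xl _]].
- by lra.
- by apply: logistic_fixed; lra.
- by move=> x; exact: logistic_gt.
- exact: logistic_lt.
Qed.

(** The left end escapes, whether the other fixed point lies in the increasing lap or beyond the
    critical point. *)
Lemma logistic_zero_repelling lam : 1 < lam <= 4 ->
  ~ attracting_set `[0, 1] (logistic lam) (forward_orbit (logistic lam) 0).
Proof.
move=> hl; apply: escapes_not_attracting.
have uT : unimodal (logistic lam) 0 (1 / 2) 1 by apply: logistic_unimodal; lra.
have li : lam^-1 < 1 by rewrite invf_lt1; lra.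
have l0 : 0 < lam^-1 by rewrite invr_gt0; lra.
have fixp : logistic lam (1 - lam^-1) = 1 - lam^-1.
  by apply: logistic_fixed; lra.
have gt x : 0 < x < 1 - lam^-1 -> x < logistic lam x by apply: logistic_gt; lra.
have [pc|cp] := leP (1 - lam^-1) (1 / 2).
  by apply: (escapes_left_end_monotone uT _ fixp gt); lra.
have [||q [c1 [b1 re]]] := restrictive_exists uT _ _ fixp;
  last exact: (escapes_left_end uT re gt).
- have /andP[] // : 0 <= logistic lam (1 / 2) <= 1.
  by apply: logistic_bound; lra.
- by lra.
Qed.

Lemma finite_periodic_points lam : 0 <= lam <= 4 -> lam < feigenbaum R ->
  exists s : seq R, forall x m, 0 <= x <= 1 -> (0 < m)%N ->
    iter m (logistic lam) x = x -> x \in s.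
Proof.
move=> hl lf.
have /finite_fsetP[S hS] :
    finite_set (periodic_points `[0, 1] (logistic lam)).
  apply: contrapT => inf_; move: lf; rewrite ltNge => /negP; apply.
  apply: ge_inf; last by [].
  by exists 0 => y [/andP[]].
exists S => x m hx m0 hm.
have : periodic_points `[0, 1] (logistic lam) x.
  by split; [rewrite /= in_itv|exists m].
by rewrite hS.
Qed.

End Logistic.

Theorem theorem32 (R : realType) (lam : R) (hlam : 0 <= lam <= 4) :
  (attracting_periodic_point `[0, 1] (logistic lam) 1 0 ->
   hpol `[0, 1] (logistic lam) = 0%E) /\
  (1 < lam < feigenbaum R -> forall n : nat,
   (exists p : R,
      attracting_periodic_point `[0, 1] (logistic lam) (2 ^ n)%N p) ->
   hpol `[0, 1] (logistic lam) = (n.+1%:R)%:E).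
Proof.
split=> [[_ _ attr]|/andP[l1 lf] n [p [pI lp attr]]].
  have l1 : lam <= 1.
    rewrite leNgt; apply/negP => l1; apply: logistic_zero_repelling attr.
    by rewrite l1; case/andP: hlam.
  rewrite (@hpol_eq _ 0%N) // => [e e0|].
    apply: pol_upper_global_sink => //; first exact: logistic_continuous.
    - by rewrite /logistic mulr0 mul0r.
    - by move=> x; exact: logistic_bound.
    - move=> x hx; rewrite -subr_gt0.
      have -> : x - logistic lam x = x * ((1 - lam) + lam * x).
        by rewrite /logistic; ring.
      (* The second factor is positive because of [1 - lam] when [lam] is 0, and because of
         [lam * x] otherwise. *)
      have [->|l0] := eqVneq lam 0; first by rewrite mul0r; lra.
      rewrite mulr_gt0 ?ltr_wpDl ?mulr_gt0 ?lt_neqAle 1?eq_sym ?l0; lra.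
  by apply: (@pol_lower0 _ _ _ 0); rewrite /= in_itv /= lexx ler01.
have uT : unimodal (logistic lam) 0 (1 / 2) 1 by apply: logistic_unimodal; lra.
have /andP[_ Tc1] : 0 <= logistic lam (1 / 2) <= 1.
  by apply: logistic_bound; lra.
have [s per] := finite_periodic_points hlam lf.
have [h [up lo hper]] :=
  cascade_height_exists uT Tc1 (logistic_dichotomy l1) per.
rewrite (hpol_eq up) //; last first.
  by apply: pol_lowerS lo => x; rewrite /= !in_itv /=; lra.
move: pI; rewrite /= in_itv /= => pI.
(* Attraction excludes both [p = 0] and escape, so [2 ^ n = 2 ^ h.-1], that is [h = n.+1]. *)
have [[p0 _]|[_ h0 kh]|esc] := hper _ _ pI lp.
- by exfalso; move: attr; rewrite p0; apply: logistic_zero_repelling; lra.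
- by move/eqP: kh; rewrite eqn_exp2l // => /eqP ->; rewrite prednK.
- by exfalso; exact: escapes_not_attracting esc attr.
Qed.
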